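(* Let $r\ge1$ be an integer. The Lie algebras $\mathfrak n_{r,0}$ and $\mathfrak n_{0,r}$ are integral isomorphic if and only if $r$ is congruent to $0$, $1$, $2$ or $4$ modulo $8$.
   Context: For integers $r,s\ge 0$ with $r+s\ge1$, $\mathbb R^{r,s}$ is $\mathbb R^{r+s}$ with $\langle Z,W\rangle_{r,s}=\sum_{i=1}^r Z_iW_i-\sum_{j=r+1}^{r+s}Z_jW_j$, and $\mathrm{Cl}_{r,s}$ is the real unital associative algebra generated by $\mathbb R^{r,s}$ subject to $Z\otimes Z=-\langle Z,Z\rangle_{r,s}\,1$. A scalar product is a non-degenerate (possibly indefinite) symmetric bilinear form. An admissible $\mathrm{Cl}_{r,s}$-module is a non-zero finite-dimensional real vector space $\mathfrak v$ with a representation $J:\mathrm{Cl}_{r,s}\to\mathrm{End}(\mathfrak v)$ and a scalar product $\langle\cdot,\cdot\rangle_{\mathfrak v}$ such that $\langle J_Zv,w\rangle_{\mathfrak v}=-\langle v,J_Zw\rangle_{\mathfrak v}$ for all $Z\in\mathbb R^{r,s}$, $v,w\in\mathfrak v$. It is minimal if its dimension is minimal among admissible $\mathrm{Cl}_{r,s}$-modules. The associated pseudo $H$-type Lie algebra is $\mathfrak n=\mathfrak v\oplus\mathbb R^{r,s}$ (orthogonal sum), with center $\mathbb R^{r,s}$ and bracket $[\cdot,\cdot]:\mathfrak v\times\mathfrak v\to\mathbb R^{r,s}$ determined by $\langle J_Zv,w\rangle_{\mathfrak v}=\langle Z,[v,w]\rangle_{r,s}$ for all $Z\in\mathbb R^{r,s}$,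 $v,w\in\mathfrak v$. The notation $\mathfrak n_{r,s}=\mathfrak v_{r,s}\oplus\mathfrak z_{r,s}$, $\mathfrak z_{r,s}=\mathbb R^{r,s}$, stands for the pseudo $H$-type Lie algebra built from a minimal admissible module $\mathfrak v_{r,s}$ (for $s=0$ the scalar product on $\mathfrak v_{r,0}$ is positive definite). Integral basis: a basis $\{v_1,\dots,v_m,Z_1,\dots,Z_n\}$ of a pseudo $H$-type Lie algebra $\mathfrak v\oplus\mathfrak z$, orthonormal (pairwise orthogonal, with $\langle x,x\rangle=\pm1$ for each basis vector $x$), with $v_\alpha\in\mathfrak v$, $Z_k\in\mathfrak z$, such that each $[v_\alpha,v_\beta]$ is either $0$ or $\pm Z_k$ for some $k$, and for all $k,\alpha$ there is exactly one $\beta$ with $[v_\alpha,v_\beta]=\pm Z_k$. Two pseudo $H$-type Lie algebras $\mathfrak n,\tilde{\mathfrak n}$ are integral isomorphic if there are integral bases $\{v_1,\dots,v_m,Z_1,\dots,Z_n\}$ of $\mathfrak n$ and $\{\tilde v_1,\dots,\tilde v_m,\tilde Z_1,\dots,\tilde Z_n\}$ of $\tilde{\mathfrak n}$ and a Lie algebra isomorphism $f:\mathfrak n\to\tilde{\mathfrak n}$ with $f(v_i)=\tilde v_i$ and $f(Z_k)=\tilde Z_k$ for all $i,k$. *)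

(* Defs.v *)
From HB Require Import structures.
From mathcomp Require Import all_boot all_order all_algebra.
From mathcomp Require Import boolp reals.

Set Implicit Arguments.
Unset Strict Implicit.
Unset Printing Implicit Defensive.

Import GRing.Theory Num.Theory.
Local Open Scope ring_scope.
Local Open Scope quotient_scope.

Definition pseudo_dot (R : realType) (r s : nat) (Z W : 'rV[R]_(r + s)) : R :=
  \sum_(i < r) Z 0 (lshift s i) * W 0 (lshift s i)
  - \sum_(j < s) Z 0 (rshift r j) * W 0 (rshift r j).

(* The Clifford algebra Cl_{r,s} is presented by generators and relations: the carrier is the quotient of
   the formal algebra expressions over R^{r,s} by the least congruence
   containing the axioms of unital associative R-algebras, the linearity of
   [CGen] and the Clifford relation. *)

Inductive cterm (R : realType) (r s : nat) : Type :=
| CGen of 'rV[R]_(r + s)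
| CZero
| COne
| CAdd of cterm R r s & cterm R r s
| CMul of cterm R r s & cterm R r s
| CScale of R & cterm R r s.
Arguments CZero {R r s}.
Arguments COne {R r s}.

Inductive cterm_eq (R : realType) (r s : nat) :
    cterm R r s -> cterm R r s -> Prop :=
| CE_refl t : cterm_eq t t
| CE_sym t u : cterm_eq t u -> cterm_eq u t
| CE_trans t u w : cterm_eq t u -> cterm_eq u w -> cterm_eq t w
| CE_add t t' u u' : cterm_eq t t' -> cterm_eq u u' ->
    cterm_eq (CAdd t u) (CAdd t' u')
| CE_mul t t' u u' : cterm_eq t t' -> cterm_eq u u' ->
    cterm_eq (CMul t u) (CMul t' u')
| CE_scale a t t' : cterm_eq t t' -> cterm_eq (CScale a t) (CScale a t')
| CE_addA t u w : cterm_eq (CAdd t (CAdd u w)) (CAdd (CAdd t u) w)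
| CE_addC t u : cterm_eq (CAdd t u) (CAdd u t)
| CE_add0 t : cterm_eq (CAdd CZero t) t
| CE_addN t : cterm_eq (CAdd (CScale (-1) t) t) CZero
| CE_mulA t u w : cterm_eq (CMul t (CMul u w)) (CMul (CMul t u) w)
| CE_mul1l t : cterm_eq (CMul COne t) t
| CE_mul1r t : cterm_eq (CMul t COne) t
| CE_mulDl t u w : cterm_eq (CMul (CAdd t u) w) (CAdd (CMul t w) (CMul u w))
| CE_mulDr t u w : cterm_eq (CMul t (CAdd u w)) (CAdd (CMul t u) (CMul t w))
| CE_scaleA a b t : cterm_eq (CScale a (CScale b t)) (CScale (a * b) t)
| CE_scale1 t : cterm_eq (CScale 1 t) t
| CE_scaleDr a t u :
    cterm_eq (CScale a (CAdd t u)) (CAdd (CScale a t) (CScale a u))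
| CE_scaleDl a b t :
    cterm_eq (CScale (a + b) t) (CAdd (CScale a t) (CScale b t))
| CE_scaleAl a t u : cterm_eq (CScale a (CMul t u)) (CMul (CScale a t) u)
| CE_scaleAr a t u : cterm_eq (CScale a (CMul t u)) (CMul t (CScale a u))
| CE_genD Z W : cterm_eq (CGen (Z + W)) (CAdd (CGen Z) (CGen W))
| CE_genZ a Z : cterm_eq (CGen (a *: Z)) (CScale a (CGen Z))
| CE_clifford Z :
    cterm_eq (CMul (CGen Z) (CGen Z)) (CScale (- pseudo_dot Z Z) COne).

Section CliffordAlgebra.
Variables (R : realType) (r s : nat).
Local Notation term := {classic (cterm R r s)}.

Definition cterm_eqb (t u : term) : bool := `[< cterm_eq t u >].

Fact cterm_eqb_equiv : equiv_class_of cterm_eqb.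
Proof.
split=> [t|t u|u t w]; first by apply/asboolP/CE_refl.
- by apply/asboolP/asboolP => /CE_sym.
- by move=> /asboolP tu /asboolP uw; apply/asboolP; apply: CE_trans tu uw.
Qed.

Canonical cterm_equiv : equiv_rel term := EquivRelPack cterm_eqb_equiv.

Definition clifford := {eq_quot cterm_equiv}.
HB.instance Definition _ := Choice.on clifford.
HB.instance Definition _ := Quotient.on clifford.

Implicit Types (t u w : term) (x y : clifford) (a b : R).

Definition cl_class t : clifford := \pi_clifford t.
Definition cl_repr x : term := repr x.

Lemma cl_classP t u : cl_class t = cl_class u <-> cterm_eq t u.
Proof.
rewrite /cl_class; split; first by move/eqmodP => /= /asboolP.
by move=> tu; apply/eqmodP/asboolP.
Qed.

Lemma cl_reprK x : cl_class (cl_repr x) = x.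
Proof. exact: reprK. Qed.

Lemma cl_repr_class t : cterm_eq (cl_repr (cl_class t)) t.
Proof. by apply/cl_classP; rewrite cl_reprK. Qed.

Definition cl_add x y := cl_class (CAdd (cl_repr x) (cl_repr y)).
Definition cl_mul x y := cl_class (CMul (cl_repr x) (cl_repr y)).
Definition cl_scale a x := cl_class (CScale a (cl_repr x)).
Definition cl_opp x := cl_scale (-1) x.

Lemma cl_addE t u : cl_add (cl_class t) (cl_class u) = cl_class (CAdd t u).
Proof. by apply/cl_classP; apply: CE_add; apply: cl_repr_class. Qed.

Lemma cl_mulE t u : cl_mul (cl_class t) (cl_class u) = cl_class (CMul t u).
Proof. by apply/cl_classP; apply: CE_mul; apply: cl_repr_class. Qed.

Lemma cl_scaleE a t : cl_scale a (cl_class t) = cl_class (CScale a t).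
Proof. by apply/cl_classP; apply: CE_scale; apply: cl_repr_class. Qed.

Let clE := (cl_addE, cl_mulE, cl_scaleE).

Fact cl_addA : associative cl_add.
Proof.
move=> x y z; rewrite -[x]cl_reprK -[y]cl_reprK -[z]cl_reprK !clE.
exact/cl_classP/CE_addA.
Qed.

Fact cl_addC : commutative cl_add.
Proof.
by move=> x y; rewrite -[x]cl_reprK -[y]cl_reprK !clE; apply/cl_classP/CE_addC.
Qed.

Fact cl_add0 : left_id (cl_class CZero) cl_add.
Proof. by move=> x; rewrite -[x]cl_reprK !clE; apply/cl_classP/CE_add0. Qed.

Fact cl_addN : left_inverse (cl_class CZero) cl_opp cl_add.
Proof.
by move=> x; rewrite -[x]cl_reprK /cl_opp !clE; apply/cl_classP/CE_addN.
Qed.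

HB.instance Definition _ :=
  GRing.isZmodule.Build clifford cl_addA cl_addC cl_add0 cl_addN.

(* Nontriviality of the quotient, which the algebra structures of the library
   require, is witnessed by Clifford matrices of size 2 ^ (r + s). *)

Section Eval.
Variables (d : nat) (J : 'rV[R]_(r + s) -> 'M[R]_d).

Fixpoint cterm_eval (t : cterm R r s) : 'M[R]_d :=
  match t with
  | CGen Z => J Z
  | CZero => 0
  | COne => 1%:M
  | CAdd t u => cterm_eval t + cterm_eval u
  | CMul t u => cterm_eval t *m cterm_eval u
  | CScale a t => a *: cterm_eval t
  end.

Hypothesis JD : forall Z W, J (Z + W) = J Z + J W.
Hypothesis JZ : forall a Z, J (a *: Z) = a *: J Z.
Hypothesis Jsq : forall Z, J Z *m J Z = (- pseudo_dot Z Z)%:M.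

Lemma cterm_eval_eq t u : cterm_eq t u -> cterm_eval t = cterm_eval u.
Proof.
elim=> //= {t u}.
- by move=> t u w _ -> _ ->.
- by move=> t t' u u' _ -> _ ->.
- by move=> t t' u u' _ -> _ ->.
- by move=> a t t' _ ->.
- by move=> t u w; rewrite addrA.
- by move=> t u; rewrite addrC.
- by move=> t; rewrite add0r.
- by move=> t; rewrite scaleN1r addNr.
- by move=> t u w; rewrite mulmxA.
- by move=> t; rewrite mul1mx.
- by move=> t; rewrite mulmx1.
- by move=> t u w; rewrite mulmxDl.
- by move=> t u w; rewrite mulmxDr.
- by move=> a b t; rewrite scalerA.
- by move=> t; rewrite scale1r.
- by move=> a t u; rewrite scalerDr.
- by move=> a b t; rewrite scalerDl.
- by move=> a t u; rewrite scalemxAl.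
- by move=> a t u; rewrite scalemxAr.
- by move=> Z; rewrite Jsq scalemx1.
Qed.

End Eval.

Fixpoint cdim (n : nat) : nat := if n is n'.+1 then (cdim n' + cdim n')%N else 1.

Fixpoint cmx (e z : nat -> R) (n : nat) : 'M[R]_(cdim n) :=
  if n is n'.+1 then
    block_mx (cmx e z n') ((z n')%:M) ((e n' * z n')%:M) (- cmx e z n')
  else 0.

Lemma cmxD (e z w : nat -> R) n : cmx e (fun i => z i + w i) n = cmx e z n + cmx e w n.
Proof.
elim: n => [|n IHn] /=; first by rewrite addr0.
by rewrite IHn add_block_mx opprD mulrDr !raddfD.
Qed.

Lemma cmxZ (e : nat -> R) a (z : nat -> R) n : cmx e (fun i => a * z i) n = a *: cmx e z n.
Proof.
elim: n => [|n IHn] /=; first by rewrite scaler0.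
by rewrite IHn scale_block_mx scalerN mulrCA !scale_scalar_mx.
Qed.

Lemma cmx_sq (e z : nat -> R) n :
  cmx e z n *m cmx e z n = (\sum_(i < n) e i * (z i * z i))%:M.
Proof.
elim: n => [|n IHn] /=; first by rewrite big_ord0 mul0mx raddf0.
rewrite mulmx_block IHn !mulNmx !mulmxN opprK IHn -!scalar_mxM.
rewrite !mul_scalar_mx !mul_mx_scalar !subrr big_ord_recr /=.
have -> : z n * (e n * z n) = e n * (z n * z n) by rewrite mulrCA.
rewrite -mulrA [_ + (\sum__ _)%:M]addrC -!raddfD /=.
by rewrite scalar_mx_block.
Qed.

Lemma cdim_gt0 n : (0 < cdim n)%N.
Proof. by elim: n => //= n IHn; rewrite addn_gt0 IHn. Qed.

Let sgn (i : nat) : R := if (i < r)%N then -1 else 1.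
Let coord (Z : 'rV[R]_(r + s)) (i : nat) : R :=
  if insub i is Some k then Z 0 k else 0.
Let cJ (Z : 'rV[R]_(r + s)) := cmx sgn (coord Z) (r + s).

Fact clifford_nontrivial : cl_class COne <> cl_class CZero.
Proof.
move/cl_classP => h.
have coordE Z (k : 'I_(r + s)) : coord Z k = Z 0 k by rewrite /coord valK.
suff /(_ _ _ h) : forall t u, cterm_eq t u -> cterm_eval cJ t = cterm_eval cJ u.
  move=> /= /matrixP /(_ (Ordinal (cdim_gt0 _)) (Ordinal (cdim_gt0 _))).
  by rewrite !mxE eqxx => /eqP; rewrite oner_eq0.
apply: cterm_eval_eq => [Z W|a Z|Z]; rewrite /cJ.
- rewrite -cmxD.
  suff -> : coord (Z + W) = (fun i => coord Z i + coord W i) by [].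
  by apply/funext => i; rewrite /coord; case: insub => [k|]; rewrite ?mxE ?addr0.
- rewrite -cmxZ.
  suff -> : coord (a *: Z) = (fun i => a * coord Z i) by [].
  by apply/funext => i; rewrite /coord; case: insub => [k|]; rewrite ?mxE ?mulr0.
- rewrite cmx_sq; congr (_%:M).
  under eq_bigr do rewrite coordE.
  rewrite big_split_ord /= /pseudo_dot opprB addrC -sumrN.
  congr (_ + _); apply: eq_bigr => i _; rewrite /sgn /=.
    by rewrite ltnNge leq_addr mul1r.
  by rewrite ltn_ord mulN1r.
Qed.

Fact cl_mulA : associative cl_mul.
Proof.
move=> x y z; rewrite -[x]cl_reprK -[y]cl_reprK -[z]cl_reprK !clE.
exact/cl_classP/CE_mulA.
Qed.

Fact cl_mul1l : left_id (cl_class COne) cl_mul.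
Proof. by move=> x; rewrite -[x]cl_reprK !clE; apply/cl_classP/CE_mul1l. Qed.

Fact cl_mul1r : right_id (cl_class COne) cl_mul.
Proof. by move=> x; rewrite -[x]cl_reprK !clE; apply/cl_classP/CE_mul1r. Qed.

Fact cl_mulDl : left_distributive cl_mul +%R.
Proof.
move=> x y z; rewrite /GRing.add /= -[x]cl_reprK -[y]cl_reprK -[z]cl_reprK !clE.
exact/cl_classP/CE_mulDl.
Qed.

Fact cl_mulDr : right_distributive cl_mul +%R.
Proof.
move=> x y z; rewrite /GRing.add /= -[x]cl_reprK -[y]cl_reprK -[z]cl_reprK !clE.
exact/cl_classP/CE_mulDr.
Qed.

Fact cl_one_neq0 : cl_class COne != 0.
Proof. by apply/eqP; apply: clifford_nontrivial. Qed.

HB.instance Definition _ := GRing.Zmodule_isNzRing.Build clifford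
  cl_mulA cl_mul1l cl_mul1r cl_mulDl cl_mulDr cl_one_neq0.

Fact cl_scaleA a b x : cl_scale a (cl_scale b x) = cl_scale (a * b) x.
Proof. by rewrite -[x]cl_reprK !clE; apply/cl_classP/CE_scaleA. Qed.

Fact cl_scale1 : left_id 1 cl_scale.
Proof. by move=> x; rewrite -[x]cl_reprK !clE; apply/cl_classP/CE_scale1. Qed.

Fact cl_scaleDr : right_distributive cl_scale +%R.
Proof.
move=> a x y; rewrite /GRing.add /= -[x]cl_reprK -[y]cl_reprK !clE.
exact/cl_classP/CE_scaleDr.
Qed.

Fact cl_scaleDl x : {morph cl_scale^~ x : a b / a + b}.
Proof.
move=> a b; rewrite [RHS]/GRing.add /= -[x]cl_reprK !clE.
exact/cl_classP/CE_scaleDl.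
Qed.

HB.instance Definition _ := GRing.Zmodule_isLmodule.Build R clifford
  cl_scaleA cl_scale1 cl_scaleDr cl_scaleDl.

Fact cl_scaleAl a x y : a *: (x * y) = (a *: x) * y.
Proof.
rewrite /GRing.mul /GRing.scale /= -[x]cl_reprK -[y]cl_reprK !clE.
exact/cl_classP/CE_scaleAl.
Qed.

HB.instance Definition _ :=
  GRing.Lmodule_isLalgebra.Build R clifford cl_scaleAl.

Fact cl_scaleAr a x y : a *: (x * y) = x * (a *: y).
Proof.
rewrite /GRing.mul /GRing.scale /= -[x]cl_reprK -[y]cl_reprK !clE.
exact/cl_classP/CE_scaleAr.
Qed.

HB.instance Definition _ :=
  GRing.Lalgebra_isAlgebra.Build R clifford cl_scaleAr.

Definition cl_gen (Z : 'rV[R]_(r + s)) : clifford := cl_class (CGen Z).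

Lemma cl_genD Z W : cl_gen (Z + W) = cl_gen Z + cl_gen W.
Proof. by rewrite [RHS]cl_addE; apply/cl_classP/CE_genD. Qed.

Lemma cl_genZ a Z : cl_gen (a *: Z) = a *: cl_gen Z.
Proof. by rewrite [RHS]cl_scaleE; apply/cl_classP/CE_genZ. Qed.

Lemma cl_gen_sq Z : cl_gen Z * cl_gen Z = (- pseudo_dot Z Z) *: 1.
Proof.
rewrite [LHS]cl_mulE [RHS]cl_scaleE; apply/cl_classP; exact: CE_clifford.
Qed.

End CliffordAlgebra.

(* The products of 'End(V) are spelled out with \o because the library only
   gives 'End(V) a ring structure under additional hypotheses on V. *)
Record clifford_repr (R : realType) (r s : nat) (V : vectType R) := CliffordRepr {
  repr_map :> {linear clifford R r s -> 'End(V)};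
  repr_map1 : repr_map 1 = \1%VF;
  repr_mapM : forall x y, repr_map (x * y) = (repr_map x \o repr_map y)%VF
}.

Record admissible (R : realType) (r s : nat) := Admissible {
  adm_space :> vectType R;
  adm_repr : clifford_repr r s adm_space;
  adm_form : {symmetric adm_space};
  adm_neq0 : (0 < \dim {:adm_space})%N;
  adm_nondeg : nondegenerate adm_form;
  adm_skew : forall (Z : 'rV[R]_(r + s)) (v w : adm_space),
    adm_form (adm_repr (cl_gen Z) v) w = - adm_form v (adm_repr (cl_gen Z) w)
}.

Definition minimal_admissible (R : realType) (r s : nat) (M : admissible R r s) :=
  forall M' : admissible R r s, (\dim {:M} <= \dim {:M'})%N.

(* The modules v_{r,s} out of which n_{r,s} is built. *)
Definition standard_module (R : realType) (r s : nat) (M : admissible R r s) :=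
  minimal_admissible M /\
  (s = 0%N -> forall v : M, v != 0 -> 0 < adm_form M v v).

Section PseudoHType.
Variables (R : realType) (r s : nat) (M : admissible R r s).

Definition htype : vectType R := ((M : vectType R) * 'rV[R]_(r + s))%type.

Definition hform (x y : htype) : R :=
  adm_form M x.1 y.1 + pseudo_dot x.2 y.2.

(* Coordinates of the vector [v, w] determined by the relation
   <J_Z v, w> = <Z, [v, w]>: take Z = e_k, for which <e_k, e_k> = +1 or -1;
   see vbracketP and vbracket_uniq. *)
Definition vbracket (v w : M) : 'rV[R]_(r + s) :=
  \row_k (pseudo_dot (delta_mx 0 k) (delta_mx 0 k : 'rV[R]_(r + s))
          * adm_form M (adm_repr M (cl_gen (delta_mx 0 k)) v) w).

Definition hbracket (x y : htype) : htype := (0, vbracket x.1 y.1).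

End PseudoHType.

Section BracketTheory.
Variables (R : realType) (r s : nat).
Implicit Types (M : admissible R r s) (Z W : 'rV[R]_(r + s)).

Let sgn (k : 'I_(r + s)) : R :=
  pseudo_dot (delta_mx 0 k) (delta_mx 0 k : 'rV[R]_(r + s)).

Lemma pseudo_dot_lshift Z i : pseudo_dot Z (delta_mx 0 (lshift s i)) = Z 0 (lshift s i).
Proof.
rewrite /pseudo_dot [X in _ - X]big1 => [|j _].
  rewrite subr0 (bigD1 i) //= big1 => [|j ji].
    by rewrite mxE !eqxx mulr1 addr0.
  by rewrite mxE eqxx (inj_eq (@lshift_inj _ _)) (negPf ji) mulr0.
by rewrite mxE eqxx eq_rlshift mulr0.
Qed.

Lemma pseudo_dot_rshift Z j : pseudo_dot Z (delta_mx 0 (rshift r j)) = - Z 0 (rshift r j).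
Proof.
rewrite /pseudo_dot big1 => [|i _].
  rewrite sub0r (bigD1 j) //= big1 => [|i ij].
    by rewrite mxE !eqxx mulr1 addr0.
  by rewrite mxE eqxx (inj_eq (@rshift_inj _ _)) (negPf ij) mulr0.
by rewrite mxE eqxx eq_lrshift mulr0.
Qed.

Lemma pseudo_dot_delta Z k : pseudo_dot Z (delta_mx 0 k) = sgn k * Z 0 k.
Proof.
rewrite /sgn; case: (split_ordP k) => [i|j] ->.
  by rewrite !pseudo_dot_lshift mxE !eqxx mul1r.
by rewrite !pseudo_dot_rshift mxE !eqxx mulN1r.
Qed.

Lemma pseudo_dot_delta_sq k : sgn k * sgn k = 1.
Proof.
rewrite /sgn; case: (split_ordP k) => [i|j] ->.
  by rewrite !pseudo_dot_lshift mxE !eqxx mul1r.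
by rewrite !pseudo_dot_rshift mxE !eqxx mulN1r opprK.
Qed.

Lemma pseudo_dotC Z W : pseudo_dot Z W = pseudo_dot W Z.
Proof. by congr (_ - _); apply: eq_bigr => i _; rewrite mulrC. Qed.

Lemma pseudo_dotE Z W : pseudo_dot Z W = \sum_k Z 0 k * (sgn k * W 0 k).
Proof.
rewrite big_split_ord /= /pseudo_dot -sumrN.
congr (_ + _); apply: eq_bigr => i _.
  by rewrite /sgn pseudo_dot_lshift mxE !eqxx mul1r.
by rewrite /sgn pseudo_dot_rshift mxE !eqxx mulN1r mulrN.
Qed.

Lemma vbracketP M (Z : 'rV[R]_(r + s)) (v w : M) :
  adm_form M (adm_repr M (cl_gen Z) v) w = pseudo_dot Z (vbracket v w).
Proof.
pose F (X : 'rV[R]_(r + s)) := adm_form M (adm_repr M (cl_gen X) v) w.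
have FD X Y : F (X + Y) = F X + F Y.
  by rewrite /F cl_genD raddfD add_lfunE linearDl.
have FZ a X : F (a *: X) = a * F X.
  by rewrite /F cl_genZ linearZ scale_lfunE linearZl_LR.
have F0 : F 0 = 0 by rewrite -(scale0r 0) FZ mul0r.
rewrite -/(F Z) pseudo_dotE {1}[Z]row_sum_delta.
rewrite (big_morph F FD F0); apply: eq_bigr => k _.
by rewrite FZ mxE -/(sgn k) [sgn k * _]mulrA pseudo_dot_delta_sq mul1r.
Qed.

Lemma vbracket_uniq M (v w : M) (b : 'rV[R]_(r + s)) :
  (forall Z, adm_form M (adm_repr M (cl_gen Z) v) w = pseudo_dot Z b) ->
  b = vbracket v w.
Proof.
move=> bP; apply/rowP => k.
have := bP (delta_mx 0 k); rewrite vbracketP pseudo_dotC pseudo_dot_delta.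
rewrite [RHS]pseudo_dotC pseudo_dot_delta => /(congr1 ( *%R (sgn k))).
by rewrite !mulrA pseudo_dot_delta_sq !mul1r.
Qed.

Lemma vbracketN M (v w : M) : vbracket w v = - vbracket v w.
Proof.
apply/rowP => k; rewrite !mxE adm_skew (hermitian_subproof _ w) /=.
by rewrite expr0 mul1r mulrN.
Qed.

Lemma vbracketDl M (a : R) (u v w : M) :
  vbracket (a *: u + v) w = a *: vbracket u w + vbracket v w.
Proof.
apply/rowP => k; rewrite !mxE linearP linearPl /=.
by rewrite mulrDr mulrCA.
Qed.

Lemma vbracket0l M (w : M) : vbracket 0 w = 0.
Proof. by apply/rowP => k; rewrite !mxE linear0 linear0l mulr0. Qed.

Lemma hbracket_linearl M (a : R) (x y z : htype M) :
  hbracket (a *: x + y) z = a *: hbracket x z + hbracket y z.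
Proof.
by rewrite /hbracket /= vbracketDl; congr pair; rewrite /= scaler0 addr0.
Qed.

Lemma hbracketxx M (x : htype M) : hbracket x x = 0.
Proof.
have /rowP vN := vbracketN x.1 x.1.
congr pair; apply/rowP => k; rewrite [RHS]mxE; apply/eqP.
by rewrite -eqNr {2}vN [X in _ == X]mxE.
Qed.

Lemma hbracket_jacobi M (x y z : htype M) :
  hbracket x (hbracket y z) + hbracket y (hbracket z x)
  + hbracket z (hbracket x y) = 0.
Proof.
have hb u v w : hbracket u (hbracket v w) = 0 :> htype M.
  by rewrite /hbracket /= vbracketN vbracket0l oppr0.
by rewrite !hb !addr0.
Qed.

End BracketTheory.

Record integral_basis (R : realType) (r s : nat) (M : admissible R r s)
    (m n : nat) (v : m.-tuple (htype M)) (Z : n.-tuple (htype M)) : Prop :=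
  IntegralBasis {
  ib_basis : basis_of fullv (v ++ Z);
  ib_v : forall a, (tnth v a).2 = 0;
  ib_Z : forall k, (tnth Z k).1 = 0;
  ib_orthogonal : {in v ++ Z &, forall x y, x != y -> hform x y = 0};
  ib_norm : {in v ++ Z, forall x, hform x x = 1 \/ hform x x = -1};
  ib_bracket : forall a b,
    hbracket (tnth v a) (tnth v b) = 0 \/
    exists k, hbracket (tnth v a) (tnth v b) = tnth Z k \/
              hbracket (tnth v a) (tnth v b) = - tnth Z k;
  ib_unique : forall k a, exists! b,
    hbracket (tnth v a) (tnth v b) = tnth Z k \/
    hbracket (tnth v a) (tnth v b) = - tnth Z k
}.

Definition lie_isomorphism (R : realType) (r s r' s' : nat)
    (M : admissible R r s) (N : admissible R r' s')
    (f : {linear htype M -> htype N}) : Prop :=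
  bijective f /\ forall x y, f (hbracket x y) = hbracket (f x) (f y).

Definition integral_isomorphic (R : realType) (r s r' s' : nat)
    (M : admissible R r s) (N : admissible R r' s') : Prop :=
  exists (m n : nat)
    (v : m.-tuple (htype M)) (Z : n.-tuple (htype M))
    (v' : m.-tuple (htype N)) (Z' : n.-tuple (htype N))
    (f : {linear htype M -> htype N}),
    [/\ integral_basis v Z, integral_basis v' Z', lie_isomorphism f,
        forall i, f (tnth v i) = tnth v' i
      & forall k, f (tnth Z k) = tnth Z' k].

(* Main.v *)
From HB Require Import structures.
Require Import Defs.
From mathcomp Require Import all_boot all_order all_algebra.
From mathcomp Require Import boolp reals.

(** Why the theorem holds.

    Let M be a minimal admissible module of Cl_{r,0} with positive form and N
    one of Cl_{0,r}, with generators acting by J_k on M and by J'_k on N.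

    An integral isomorphism carries the form of N to a form on M whose matrix
    eta, in the integral basis, is diagonal with entries 1 and -1.  Both
    brackets having the same structure constants, J'_k corresponds to eta J_k
    up to sign; as J'_k has square 1, eta is an involution anticommuting with
    J_1, ..., J_r ([iso_grading]).  The pair (J_r, eta) is then a hyperbolic
    plane: J_r eta is an involution commuting with J_1, ..., J_{r-1}, and J_r
    exchanges its two eigenspaces, each a module of Cl_{r-1,0}.  Thus
    dim v_{r,0} >= 2 dim v_{r-1,0}.  For r = 0, ..., 7 the dimension of v_{r,0}
    is 1, 2, 4, 4, 8, 8, 8, 8, and it is multiplied by 16 when r grows by 8, so
    that the inequality fails for r = 3, 5, 6, 7 modulo 8
    ([not_integral_isomorphic]).

    Conversely, for r = 0, 1, 2, 4 modulo 8, the algebra with the additional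
    generator eta has a [model]: signed permutation matrices A_1, ..., A_r and
    a diagonal sign matrix eta.  The matrices A_k with the standard form are an
    admissible module of Cl_{r,0}; the matrices eta A_k with the form eta are
    one of Cl_{0,r}.  The point of a model is that it is [universal]: any
    system of operators satisfying the relations of the A_k (resp. of the
    eta A_k) and skew for some nondegenerate form contains a copy of the model,
    isometric up to a sign.  Minimality then forces M and N to be such copies.
    The images of the canonical basis are integral bases of both algebras, and
    their structure constants are, in both cases, the entries of the A_k
    ([model_integral_isomorphic]).

    Universality is proved by splitting off one piece at a time.  A hyperbolic
    pair (f, f') of generators yields an involution f f' up to sign commuting
    with the remaining ones; an eigenspace carries the smaller system, and the
    whole is the eigenspace plus its image by f ([hyp_universal]).  Eight
    generators of the same square become four hyperbolic pairs once four of
    them are multiplied by their product, which reverses their squares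
    ([quad_universal]); this is the periodicity modulo 8.  The remaining cases
    r <= 4 are the real line, the complex plane, the quaternions, and the sum
    of two copies of the quaternions ([quat_universal]).  The same dimension
    being reached by a module with more generators (r = 3 for r = 2, and r = 7
    for r = 4), a model records both numbers of generators. *)

Set Implicit Arguments.
Unset Strict Implicit.
Unset Printing Implicit Defensive.
Import Order.TTheory GRing.Theory Num.Theory VectorInternalTheory.
Local Open Scope ring_scope.

(** * Two by two block matrices and signed permutations *)

Section Blocks.
Variable R : comNzRingType.

Definition rot_mx d : 'M[R]_(d + d) := block_mx 0 (- 1%:M) 1%:M 0.
Definition even_mx d (X : 'M[R]_d) : 'M[R]_(d + d) := block_mx X 0 0 (- X).
Definition odd_mx d (X : 'M[R]_d) : 'M[R]_(d + d) := block_mx 0 X X 0.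

Lemma anti_sym d (X Y : 'M[R]_d) : X *m Y = - (Y *m X) -> Y *m X = - (X *m Y).
Proof. by move=> ->; rewrite opprK. Qed.

Definition blockE (V : zmodType) :=
  (mulmx_block, mulmx0, mul0mx, addr0, add0r, mulmx1, mul1mx, mulmxN, mulNmx, @opprK V,
   opp_block_mx, oppr0, tr_block_mx, trmx0, trmx1, scale_block_mx, scaler0, scale1r, scaleN1r).

Section BlockAlgebra.
Variable d : nat.
Implicit Types X Y : 'M[R]_d.

Lemma even_even X Y : even_mx X *m even_mx Y = block_mx (X *m Y) 0 0 (X *m Y).
Proof. by rewrite /even_mx !blockE. Qed.

Lemma odd_odd X Y : odd_mx X *m odd_mx Y = block_mx (X *m Y) 0 0 (X *m Y).
Proof. by rewrite /odd_mx !blockE. Qed.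

Lemma even_odd X Y : even_mx X *m odd_mx Y = block_mx 0 (X *m Y) (- (X *m Y)) 0.
Proof. by rewrite /even_mx /odd_mx !blockE. Qed.

Lemma odd_even X Y : odd_mx X *m even_mx Y = block_mx 0 (- (X *m Y)) (X *m Y) 0.
Proof. by rewrite /even_mx /odd_mx !blockE. Qed.

Lemma even_anti X Y : X *m Y = - (Y *m X) -> even_mx X *m even_mx Y = - (even_mx Y *m even_mx X).
Proof. by move=> XY; rewrite !even_even XY !blockE. Qed.

Lemma odd_anti X Y : X *m Y = - (Y *m X) -> odd_mx X *m odd_mx Y = - (odd_mx Y *m odd_mx X).
Proof. by move=> XY; rewrite !odd_odd XY !blockE. Qed.

Lemma even_odd_anti X Y : X *m Y = Y *m X -> even_mx X *m odd_mx Y = - (odd_mx Y *m even_mx X).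
Proof. by move=> XY; rewrite even_odd odd_even XY !blockE. Qed.

Lemma even_rot X : even_mx X *m rot_mx d = - (rot_mx d *m even_mx X).
Proof. by rewrite /even_mx /rot_mx !blockE. Qed.

Lemma odd_rot X : odd_mx X *m rot_mx d = - (rot_mx d *m odd_mx X).
Proof. by rewrite /odd_mx /rot_mx !blockE. Qed.

Lemma even_sq X s : X *m X = s%:M -> even_mx X *m even_mx X = s%:M.
Proof. by move=> XX; rewrite even_even XX -scalar_mx_block. Qed.

Lemma odd_sq X s : X *m X = s%:M -> odd_mx X *m odd_mx X = s%:M.
Proof. by move=> XX; rewrite odd_odd XX -scalar_mx_block. Qed.

Lemma rot_sq : rot_mx d *m rot_mx d = (-1)%:M.
Proof. by rewrite /rot_mx !blockE -raddfN -scalar_mx_block. Qed.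

Lemma even_T X s : X^T = s *: X -> (even_mx X)^T = s *: even_mx X.
Proof. by move=> XT; rewrite /even_mx !blockE linearN /= XT scalerN. Qed.

Lemma odd_T X s : X^T = s *: X -> (odd_mx X)^T = s *: odd_mx X.
Proof. by move=> XT; rewrite /odd_mx !blockE XT. Qed.

Lemma rot_T : (rot_mx d)^T = -1 *: rot_mx d.
Proof. by rewrite /rot_mx !blockE raddfN /= trmx1. Qed.
End BlockAlgebra.

Definition signed_perm d (X : 'M[R]_d) :=
  forall j, exists i (b : bool), col j X = (-1) ^+ b *: delta_mx i 0.

Definition signed_diag d (X : 'M[R]_d) :=
  forall j, exists b : bool, col j X = (-1) ^+ b *: delta_mx j 0.

Lemma col_mx_delta0 d (i : 'I_d) :
  col_mx (delta_mx i 0 : 'cV[R]_d) (0 : 'cV[R]_d) = delta_mx (lshift d i) 0.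
Proof.
by apply/colP => j; rewrite !mxE; case: split_ordP => l ->; rewrite !mxE ?eqxx ?eq_shift.
Qed.

Lemma col_mx_0delta d (i : 'I_d) :
  col_mx (0 : 'cV[R]_d) (delta_mx i 0 : 'cV[R]_d) = delta_mx (rshift d i) 0.
Proof.
by apply/colP => j; rewrite !mxE; case: split_ordP => l ->; rewrite !mxE ?eqxx ?eq_shift.
Qed.

Section SignedBlocks.
Variables (d : nat) (X Y : 'M[R]_d).

Lemma signed_perm_diag_block :
  signed_perm X -> signed_perm Y -> signed_perm (block_mx X 0 0 Y).
Proof.
move=> hX hY j; case: (split_ordP j) => l -> {j}.
- have [i [b ib]] := hX l; exists (lshift d i), b.
  by rewrite block_mxEh colKl col_col_mx ib -col_mx_delta0 col0 scale_col_mx scaler0.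
- have [i [b ib]] := hY l; exists (rshift d i), b.
  by rewrite block_mxEh colKr col_col_mx ib -col_mx_0delta col0 scale_col_mx scaler0.
Qed.

Lemma signed_perm_anti_block :
  signed_perm X -> signed_perm Y -> signed_perm (block_mx 0 X Y 0).
Proof.
move=> hX hY j; case: (split_ordP j) => l -> {j}.
- have [i [b ib]] := hY l; exists (rshift d i), b.
  by rewrite block_mxEh colKl col_col_mx ib -col_mx_0delta col0 scale_col_mx scaler0.
- have [i [b ib]] := hX l; exists (lshift d i), b.
  by rewrite block_mxEh colKr col_col_mx ib -col_mx_delta0 col0 scale_col_mx scaler0.
Qed.

Lemma signed_diag_block : signed_diag X -> signed_diag Y -> signed_diag (block_mx X 0 0 Y).
Proof.
move=> hX hY j; case: (split_ordP j) => l -> {j}.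
- have [b ib] := hX l; exists b.
  by rewrite block_mxEh colKl col_col_mx ib -col_mx_delta0 col0 scale_col_mx scaler0.
- have [b ib] := hY l; exists b.
  by rewrite block_mxEh colKr col_col_mx ib -col_mx_0delta col0 scale_col_mx scaler0.
Qed.

Lemma signed_permM : signed_perm X -> signed_perm Y -> signed_perm (X *m Y).
Proof.
move=> hX hY j; have [i [b ib]] := hY j; have [l [b' lb]] := hX i.
exists l, (b (+) b'); rewrite colE -mulmxA -colE ib -scalemxAr -colE lb scalerA.
by rewrite signr_addb.
Qed.

Lemma signed_permN : signed_perm X -> signed_perm (- X).
Proof.
by move=> h j; have [i [b ib]] := h j; exists i, (~~ b); rewrite linearN /= ib signrN scaleNr.
Qed.

Lemma signed_diagN : signed_diag X -> signed_diag (- X).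
Proof.
by move=> h j; have [b ib] := h j; exists (~~ b); rewrite linearN /= ib signrN scaleNr.
Qed.

Lemma signed_perm_entry j : signed_perm X ->
  exists i (b : bool), forall l, X l j = (-1) ^+ b * (l == i)%:R.
Proof.
move=> /(_ j)[i [b h]]; exists i, b => l; move/colP: h => /(_ l).
by rewrite !mxE eqxx andbT.
Qed.
End SignedBlocks.

Lemma signed_perm1 d : signed_perm (1%:M : 'M[R]_d).
Proof. by move=> j; exists j, false; rewrite col1 scale1r. Qed.

Lemma signed_diag1 d : signed_diag (1%:M : 'M[R]_d).
Proof. by move=> j; exists false; rewrite col1 scale1r. Qed.

Lemma even_perm d (X : 'M[R]_d) : signed_perm X -> signed_perm (even_mx X).
Proof. by move=> h; apply: signed_perm_diag_block h (signed_permN h). Qed.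

Lemma odd_perm_mx d (X : 'M[R]_d) : signed_perm X -> signed_perm (odd_mx X).
Proof. by move=> h; apply: signed_perm_anti_block. Qed.

Lemma rot_perm d : signed_perm (rot_mx d).
Proof. by apply: signed_perm_anti_block; [apply: signed_permN|]; apply: signed_perm1. Qed.

Lemma even_diag d (X : 'M[R]_d) : signed_diag X -> signed_diag (even_mx X).
Proof. by move=> h; apply: signed_diag_block h (signed_diagN h). Qed.

Lemma mx11_tr (X : 'M[R]_1) : X^T = X.
Proof. by apply/matrixP=> i j; rewrite mxE !ord1. Qed.

Lemma delta_entry n (Y : 'M[R]_n) i j :
  ((delta_mx 0 i : 'rV_n) *m Y *m (delta_mx j 0 : 'cV_n)) 0 0 = Y i j.
Proof. by rewrite -rowE -colE !mxE. Qed.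

Lemma cV_sum_delta n (x : 'cV[R]_n) : x = \sum_i x i 0 *: delta_mx i 0.
Proof. by rewrite {1}[x]matrix_sum_delta; apply: eq_bigr => i _; rewrite big_ord1. Qed.

Lemma mx_eqP n p (Y Y' : 'M[R]_(n, p)) : (forall x : 'cV_p, Y *m x = Y' *m x) -> Y = Y'.
Proof.
move=> h; apply/matrixP => i j; move/colP: (h (delta_mx j 0)) => /(_ i).
by rewrite -!colE !mxE.
Qed.
End Blocks.

Lemma sqr_sign (R : pzRingType) (c : R) : c = 1 \/ c = -1 -> c * c = 1.
Proof. by case=> ->; rewrite ?mulrNN mulr1. Qed.

Lemma mx_eqN0 (R : numFieldType) m n (X : 'M[R]_(m, n)) : X = - X -> X = 0.
Proof.
move=> XN; apply/eqP; have /eqP := XN; rewrite -addr_eq0 -mulr2n -scaler_nat scaler_eq0.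
by rewrite pnatr_eq0.
Qed.
(** * Clifford systems and their models *)

Section Systems.
Variable R : rcfType.

(** The same record describes a module of Cl_{r,0} (c = 1) and one of Cl_{0,r}
    (c = -1), in both cases with k constantly -1: k i is the sign of the adjoint
    of the i-th generator and c * k i its square.  The projector P selects a
    subspace, orthogonal summand of the ambient space, on which the generators
    act; using it instead of a smaller space avoids any change of coordinates
    when an eigenspace is split off. *)
Record clifford_system m n (c : R) (k : nat -> R) (G P : 'M[R]_m)
    (E : nat -> 'M[R]_m) : Prop := CliffordSystem {
  cs_sym : G^T = G;
  cs_unit : G \in unitmx;
  cs_sq : forall i, (i < n)%N -> E i *m E i = (c * k i)%:M;
  cs_anti : forall i j, (i < n)%N -> (j < n)%N -> i != j -> E i *m E j = - (E j *m E i);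
  cs_adj : forall i, (i < n)%N -> (E i)^T *m G = k i *: (G *m E i);
  cs_idem : P *m P = P;
  cs_self : P^T *m G = G *m P;
  cs_comm : forall i, (i < n)%N -> P *m E i = E i *m P;
  cs_neq0 : P != 0 }.

(** The Gram matrix of the model when the square of each generator is
    multiplied by c: multiplying all A i by eta reverses their squares and
    leaves them (skew-)adjoint, with the same signs, for the form eta. *)
Definition twist d (c : R) (eta : 'M[R]_d) : 'M[R]_d := if c == 1 then 1%:M else eta.

(** A system contains a copy of the model, isometric up to the sign e: phi is
    the matrix of the embedding, with image in that of P. *)
Definition universal d n (k : nat -> R) (A : nat -> 'M[R]_d) (eta : 'M[R]_d) : Prop :=
  forall m c G P (E : nat -> 'M[R]_m), c = 1 \/ c = -1 -> clifford_system n c k G P E ->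
  exists e (phi : 'M[R]_(m, d)),
    [/\ e = 1 \/ e = -1, P *m phi = phi,
        forall i, (i < n)%N -> E i *m phi = phi *m (twist c eta *m A i)
      & phi^T *m G *m phi = e *: twist c eta].

(** All N generators are realised in dimension d, but only the first n of them
    together with eta, and universality concerns these n only.  The gap between
    n and N shows that d is attained by modules with more generators. *)
Record model n N d (k : nat -> R) (A : nat -> 'M[R]_d) (eta : 'M[R]_d) : Prop :=
  Model {
  mo_le : (n <= N)%N;
  mo_gt0 : (0 < d)%N;
  mo_sq : forall i, (i < N)%N -> A i *m A i = (k i)%:M;
  mo_anti : forall i j,
    (i < N)%N -> (j < N)%N -> i != j -> A i *m A j = - (A j *m A i);
  mo_sym : forall i, (i < N)%N -> (A i)^T = k i *: A i;
  mo_etaT : eta^T = eta;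
  mo_eta2 : eta *m eta = 1%:M;
  mo_eta : forall i, (i < n)%N -> eta *m A i = - (A i *m eta);
  mo_perm : forall i, (i < n)%N -> signed_perm (A i);
  mo_diag : signed_diag eta;
  mo_univ : universal n k A eta }.

Lemma twist_sq d c (eta : 'M[R]_d) : eta *m eta = 1%:M -> twist c eta *m twist c eta = 1%:M.
Proof. by rewrite /twist; case: ifP => _ //; rewrite mulmx1. Qed.

Lemma twistT d c (eta : 'M[R]_d) : eta^T = eta -> (twist c eta)^T = twist c eta.
Proof. by rewrite /twist; case: ifP => _ //; rewrite trmx1. Qed.

Lemma twist_comm d c (eta A : 'M[R]_d) : c = 1 \/ c = -1 ->
  eta *m A = - (A *m eta) -> twist c eta *m A = c *: (A *m twist c eta).
Proof.
have N11 : (-1 == 1 :> R) = false.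
  by rewrite eq_sym -addr_eq0 -mulr2n pnatr_eq0.
case=> -> ; rewrite /twist ?eqxx ?N11 => h; first by rewrite mul1mx mulmx1 scale1r.
by rewrite h scaleN1r.
Qed.

(** Polarization. *)
Lemma quad_form_neq0 m (S : 'M[R]_m) : S^T = S -> S != 0 ->
  exists v : 'cV[R]_m, (v^T *m S *m v) 0 0 != 0.
Proof.
move=> ST S0; apply: contrapT => none.
have q0 (v : 'cV[R]_m) : v^T *m S *m v = 0.
  apply/matrixP=> i j; rewrite !ord1 [RHS]mxE; apply/eqP/negP => h.
  by apply: none; exists v; apply/negP.
case/eqP: S0; apply/matrixP=> i j.
have ent a b : ((delta_mx a 0 : 'cV[R]_m)^T *m S *m (delta_mx b 0 : 'cV[R]_m)) 0 0 = S a b.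
  by rewrite trmx_delta -rowE -colE !mxE.
have := q0 (delta_mx i 0 + delta_mx j 0).
rewrite [X in X *m _ *m _]linearD /= mulmxDl mulmxDr mulmxDl mulmxDl !q0 addr0 add0r =>
  /matrixP/(_ 0 0).
rewrite [LHS]mxE !ent -{1}ST !mxE -mulr2n => /eqP.
by rewrite mulrn_eq0 /= => /eqP.
Qed.

(** The base case of universality: the restriction of G to the image of P is
    nondegenerate, hence not identically zero on the diagonal. *)
Lemma unit_vector m (G P : 'M[R]_m) : G^T = G -> G \in unitmx -> P *m P = P ->
  P^T *m G = G *m P -> P != 0 ->
  exists e (v : 'cV[R]_m), [/\ e = 1 \/ e = -1, P *m v = v & v^T *m G *m v = e%:M].
Proof.
move=> GT Gu PP PG P0.
have [||v] := @quad_form_neq0 m (G *m P).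
- by rewrite trmx_mul GT PG.
- apply: contra P0 => /eqP GP0; apply/eqP.
  by rewrite -[P]mul1mx -(mulVmx Gu) -mulmxA GP0 mulmx0.
set q := _ 0 0 => q0.
pose s := Num.sqrt `|q|.
have s0 : s != 0 by rewrite sqrtr_eq0 -ltNge normr_gt0.
have ss : s * s = `|q| by rewrite -expr2 sqr_sqrtr.
exists (Num.sg q), (s^-1 *: (P *m v)); split.
- by case: sgrP q0 => //; [left | right].
- by rewrite -scalemxAr mulmxA PP.
- rewrite !linearZ /= -!scalemxAl scalerA trmx_mul -!mulmxA [P^T *m _]mulmxA PG.
  rewrite -!mulmxA [P *m _]mulmxA PP !mulmxA.
  rewrite [X in _ *: X]mx11_scalar -[v^T *m G *m P]mulmxA -/q scale_scalar_mx.
  congr (_%:M); rewrite -invfM ss.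
  by rewrite {2}(numEsg q) mulrCA mulVf ?mulr1 ?normr_eq0.
Qed.

Lemma signed_diag_twist d c (eta : 'M[R]_d) : signed_diag eta -> signed_diag (twist c eta).
Proof. by rewrite /twist; case: ifP => // _ _; apply: signed_diag1. Qed.

(** Universality bounds the dimension from below, since an embedding with
    invertible Gram matrix has a left inverse. *)
Lemma universal_dim n d k (A : nat -> 'M[R]_d) eta m c G P (E : nat -> 'M[R]_m) :
  universal n k A eta -> eta *m eta = 1%:M -> c = 1 \/ c = -1 ->
  clifford_system n c k G P E -> (d <= m)%N.
Proof.
move=> univ eta2 c1 sys; have [e [phi [e1 _ _ phiG]]] := univ m c G P E c1 sys.
have H2 := twist_sq c eta2; set H := twist c eta in phiG H2.
have left_inv : (e *: H *m phi^T *m G) *m phi = 1%:M.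
  rewrite -[RHS]H2 -!mulmxA [phi^T *m _]mulmxA phiG -scalemxAl -scalemxAr scalerA.
  by rewrite (sqr_sign e1) scale1r.
by rewrite -(mxrank1 R d) -left_inv (leq_trans (mxrankM_maxr _ _)) // rank_leq_row.
Qed.
End Systems.

(** * Doubling an embedded model by one more generator *)

(** If phi embeds a model and f is a further generator sending the image of phi
    to a subspace orthogonal to it, then phi and f phi together embed a model of
    twice the size.  The factor c H makes the matrices of the generators in the
    new model, up to the twist, independent of c. *)
Section Doubling.
Variables (R : comNzRingType) (m d : nat) (c : R) (G f : 'M[R]_m).
Variables (phi : 'M[R]_(m, d)) (H : 'M[R]_d).
Hypotheses (cc : c * c = 1) (HH : H *m H = 1%:M) (ff : f *m f = (- c)%:M).

Definition dbl_frame := row_mx phi (c *: (f *m phi *m H)).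
Definition dbl_gram := block_mx H 0 0 (c *: H).

Lemma dbl_new :
  f *m dbl_frame = dbl_frame *m (dbl_gram *m rot_mx R d).
Proof.
rewrite /dbl_frame /dbl_gram /rot_mx mulmx_block !(mulmx0, mul0mx, addr0, add0r, mulmx1, mulmxN).
rewrite mul_row_block !(mulmx0, addr0, add0r) mul_mx_row.
rewrite -!(scalemxAl, scalemxAr) scalerA cc scale1r -[_ *m H *m H]mulmxA HH mulmx1.
by rewrite !mulmxA ff mul_scalar_mx -scalemxAl scalerA mulrN cc scaleN1r mulmxN.
Qed.

Lemma dbl_even E X : E *m phi = phi *m (H *m X) -> E *m f = - (f *m E) ->
  H *m X = c *: (X *m H) ->
  E *m dbl_frame = dbl_frame *m (dbl_gram *m even_mx X).
Proof.
move=> Ephi Ef HX.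
rewrite /dbl_frame /dbl_gram /even_mx mulmx_block !(mulmx0, mul0mx, addr0, add0r, mulmx1, mulmxN).
rewrite mul_row_block !(mulmx0, addr0, add0r) mul_mx_row Ephi.
congr row_mx; rewrite !(mulmxN, =^~ scalemxAl, =^~ scalemxAr) !mulmxA Ef mulNmx.
rewrite mulNmx -[f *m E *m phi]mulmxA Ephi HX -!scalemxAr -!scalemxAl.
rewrite !scalerN !scalerA !cc !scale1r !mulmxA.
by rewrite -![_ *m H *m H]mulmxA HH !mulmx1.
Qed.

Lemma dbl_odd E X : E *m phi = f *m phi *m X -> E *m f = - (f *m E) ->
  H *m X = X *m H ->
  E *m dbl_frame = dbl_frame *m (dbl_gram *m odd_mx X).
Proof.
move=> Ephi Ef HX.
rewrite /dbl_frame /dbl_gram /odd_mx mulmx_block !(mulmx0, mul0mx, addr0, add0r, mulmx1, mulmxN).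
rewrite mul_row_block !(mulmx0, addr0, add0r) mul_mx_row Ephi.
congr row_mx; rewrite !(mulmxN, =^~ scalemxAl, =^~ scalemxAr) !mulmxA.
  by rewrite scalerA cc scale1r -[_ *m H *m H]mulmxA HH mulmx1.
rewrite Ef mulNmx -[f *m E *m phi]mulmxA Ephi !mulmxA ff mul_scalar_mx.
rewrite -!scalemxAl mulNmx -!scalemxAl scalerN scalerA mulrN cc scaleN1r opprK.
by rewrite -!mulmxA HX.
Qed.

Lemma dbl_frame_gram e : H^T = H -> f^T *m G = - (G *m f) ->
  phi^T *m G *m phi = e *: H -> phi^T *m G *m f *m phi = 0 ->
  dbl_frame^T *m G *m dbl_frame = e *: dbl_gram.
Proof.
move=> HT fG phiG cross.
have cross' : phi^T *m f^T *m G *m phi = 0.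
  by rewrite -[phi^T *m _ *m G]mulmxA fG mulmxN mulNmx mulmxA cross oppr0.
rewrite /dbl_frame tr_row_mx mul_col_mx mul_col_row /dbl_gram scale_block_mx !scaler0.
have fGf : f^T *m G *m f = c *: G.
  by rewrite fG mulNmx -mulmxA ff mul_mx_scalar scaleNr opprK.
rewrite !linearZ /= -!scalemxAl !trmx_mul HT !mulmxA.
rewrite cross mul0mx scaler0 phiG; congr block_mx.
  by rewrite -!mulmxA [f^T *m _]mulmxA [phi^T *m _]mulmxA [phi^T *m _]mulmxA cross' mulmx0 scaler0.
rewrite -[H *m phi^T *m f^T *m G *m f]mulmxA.
rewrite -[H *m phi^T *m f^T *m _]mulmxA [f^T *m (G *m f)]mulmxA fGf.
rewrite -!scalemxAr -!scalemxAl -[H *m _ *m _]mulmxA -[H *m _ *m _]mulmxA phiG.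
by rewrite -!scalemxAr -!scalemxAl HH mul1mx !scalerA cc mul1r mulrC.
Qed.
End Doubling.

Lemma twist_dbl (R : rcfType) d (c : R) (eta : 'M[R]_d) : c = 1 \/ c = -1 ->
  twist c (even_mx eta) = dbl_gram c (twist c eta).
Proof.
have N11 : (-1 == 1 :> R) = false.
  by rewrite eq_sym -addr_eq0 -mulr2n pnatr_eq0.
case=> ->; rewrite /twist /dbl_gram /even_mx ?eqxx ?N11.
  by rewrite scale1r -scalar_mx_block.
by rewrite scaleN1r.
Qed.

(** * Splitting along an involution *)

Section Split.
Variable R : rcfType.

(** The projector on the intersection of the image of P with the fixed space of
    the involution T. *)
Definition split_proj m (P T : 'M[R]_m) := 2^-1 *: (P + P *m T).

Section SplitProj.
Variables (m : nat) (G P T : 'M[R]_m).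
Hypotheses (PP : P *m P = P) (PG : P^T *m G = G *m P) (TT : T *m T = 1%:M)
  (TG : T^T *m G = G *m T) (PT : P *m T = T *m P).
Let P' := split_proj P T.

Lemma split_projT : T *m P' = P'.
Proof.
by rewrite /P' /split_proj -scalemxAr mulmxDr mulmxA -PT -mulmxA TT mulmx1 addrC.
Qed.

Lemma split_projP : P *m P' = P'.
Proof. by rewrite /P' /split_proj -scalemxAr mulmxDr mulmxA PP. Qed.

Lemma split_proj_comm X : P *m X = X *m P -> T *m X = X *m T -> P' *m X = X *m P'.
Proof.
move=> PX TX; rewrite /P' /split_proj -scalemxAr -scalemxAl mulmxDl mulmxDr PX.
by rewrite -mulmxA TX !mulmxA PX.
Qed.

Lemma split_proj_idem : P' *m P' = P'.
Proof.
rewrite {1}/P' /split_proj -scalemxAl mulmxDl -mulmxA split_projT split_projP.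
by rewrite -mulr2n -scaler_nat scalerA mulVf ?scale1r ?pnatr_eq0.
Qed.

Lemma split_proj_self : P'^T *m G = G *m P'.
Proof.
rewrite /P' /split_proj linearZ /= linearD /= -scalemxAl -scalemxAr mulmxDl mulmxDr.
by rewrite PG PT trmx_mul -mulmxA TG mulmxA PG -mulmxA PT.
Qed.

(** f exchanges the two eigenspaces of T, so none of them vanishes. *)
Lemma split_proj_neq0 f s : s != 0 -> f *m f = s%:M -> P *m f = f *m P ->
  f *m T = - (T *m f) -> P != 0 -> P' != 0.
Proof.
move=> s0 ff Pf fT; apply: contra => /eqP /(congr1 (fun X => 2 *: X)).
rewrite /P' /split_proj scalerA mulfV ?pnatr_eq0 // scale1r scaler0 => /eqP.
rewrite addr_eq0 => /eqP PT'.
have : f *m P *m f = - (f *m (P *m T) *m f) by rewrite {1}PT' mulmxN mulNmx.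
rewrite PT mulmxA fT !mulNmx opprK -[T *m f *m P]mulmxA -Pf -!mulmxA ff mulmxA -PT.
rewrite !mul_mx_scalar => /(congr1 (fun X => s^-1 *: X)); rewrite !scalerA mulVf // !scale1r => h.
by apply/eqP/mx_eqN0; rewrite {1}PT' -h.
Qed.

Lemma split_proj_fix d (phi : 'M[R]_(m, d)) : P' *m phi = phi -> T *m phi = phi /\ P *m phi = phi.
Proof. by move=> <-; rewrite !mulmxA split_projT split_projP. Qed.
End SplitProj.

(** f sends the fixed space of T to the other eigenspace, orthogonal to it. *)
Lemma eigen_orthogonal m d (G T f : 'M[R]_m) (phi : 'M[R]_(m, d)) :
  T^T *m G = G *m T -> T *m phi = phi -> f *m T = - (T *m f) -> phi^T *m G *m f *m phi = 0.
Proof.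
move=> TG Tphi fT; apply: mx_eqN0.
rewrite -{1}Tphi trmx_mul -!mulmxA [T^T *m _]mulmxA TG.
rewrite -!mulmxA [T *m _]mulmxA -[T *m f]opprK -fT mulNmx -!mulmxA Tphi.
by rewrite !mulmxN.
Qed.
End Split.

(** * Adding a hyperbolic pair of generators *)

Section Hyperbolic.
Variable R : rcfType.

Definition hyp_sign (k : nat -> R) i := match i with 0 => -1 | 1 => 1 | i.+2 => k i end.

Definition hyp_gens d (A : nat -> 'M[R]_d) i : 'M[R]_(d + d) :=
  match i with
  | 0 => rot_mx R d
  | 1 => odd_mx 1%:M
  | i.+2 => even_mx (A i)
  end.

(** The two generators f, f' of the pair have opposite squares, so T = -c f f' is
    an involution.  It commutes with the remaining generators, which therefore
    form a smaller system on its fixed space; f sends this space to its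
    orthogonal complement, and f' = f on it. *)
Lemma hyp_universal n N d k (A : nat -> 'M[R]_d) eta : model n N k A eta ->
  universal n.+2 (hyp_sign k) (hyp_gens A) (even_mx eta).
Proof.
move=> mo m c G P E c1 sys; have cc := sqr_sign c1.
have c0 : c != 0 by case: c1 => ->; rewrite ?oppr_eq0 oner_eq0.
have f1f1 : E 0 *m E 0 = (- c)%:M by rewrite (cs_sq sys) //= mulrN1.
have f2f2 : E 1 *m E 1 = c%:M by rewrite (cs_sq sys) //= mulr1.
have f21 : E 1 *m E 0 = - (E 0 *m E 1) by rewrite (cs_anti sys).
have fG : (E 0)^T *m G = - (G *m E 0) by rewrite (cs_adj sys) //= scaleN1r.
have f2G : (E 1)^T *m G = G *m E 1 by rewrite (cs_adj sys) //= scale1r.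
pose T := - c *: (E 0 *m E 1).
have TT : T *m T = 1%:M.
  rewrite /T -scalemxAl -scalemxAr scalerA mulrNN cc scale1r.
  rewrite -mulmxA [E 1 *m _]mulmxA f21 mulNmx -[_ *m E 1 *m E 1]mulmxA f2f2 mulmxN mulmxA f1f1.
  by rewrite -scalar_mxM mulNr cc raddfN /= opprK.
have TG : T^T *m G = G *m T.
  rewrite /T linearZ /= -scalemxAl trmx_mul -mulmxA fG mulmxN mulmxA f2G.
  by rewrite -mulmxA f21 mulmxN opprK scalemxAr.
have PT : P *m T = T *m P.
  by rewrite /T -scalemxAr mulmxA (cs_comm sys) // -mulmxA (cs_comm sys) // -scalemxAl !mulmxA.
have fT : E 0 *m T = - (T *m E 0).
  by rewrite /T -scalemxAr -scalemxAl -mulmxA f21 mulmxN scalerN opprK.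
have restT i : (i < n)%N -> T *m E i.+2 = E i.+2 *m T.
  move=> lt; rewrite /T -scalemxAl -scalemxAr; congr (_ *: _).
  rewrite -mulmxA [E 1 *m _](cs_anti sys) // mulmxN !mulmxA.
  by rewrite [E 0 *m E i.+2](cs_anti sys) // mulNmx opprK.
have [|e [phi [e1 Pphi Ephi phiG]]] :=
    @mo_univ _ _ _ _ _ _ _ mo m c G (split_proj P T) (fun i => E i.+2) c1.
- have PP := cs_idem sys; have PG := cs_self sys.
  constructor.
  + exact: cs_sym sys.
  + exact: cs_unit sys.
  + by move=> i lt; rewrite (cs_sq sys).
  + by move=> i j lti ltj ij; rewrite (cs_anti sys).
  + by move=> i lt; rewrite (cs_adj sys).
  + exact: split_proj_idem.
  + exact: split_proj_self.
  + by move=> i lt; apply: split_proj_comm; [apply: (cs_comm sys) | apply: restT].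
  + apply: (@split_proj_neq0 _ _ P T PT (E 0) (- c)) => //; first by rewrite oppr_eq0.
      by rewrite (cs_comm sys).
    exact: cs_neq0 sys.
have [Tphi {}Pphi] := split_proj_fix (cs_idem sys) TT PT Pphi.
have f2phi : E 1 *m phi = E 0 *m phi *m 1%:M.
  rewrite mulmx1 -{2}Tphi /T -scalemxAl -scalemxAr !mulmxA f1f1 mul_scalar_mx -scalemxAl scalerA.
  by rewrite mulrNN cc scale1r.
set H := twist c eta in Ephi phiG.
have HH : H *m H = 1%:M by apply: twist_sq; apply: mo_eta2 mo.
exists e, (dbl_frame c (E 0) phi H); rewrite twist_dbl // -/H; split=> //.
- rewrite mul_mx_row Pphi -scalemxAr !mulmxA (cs_comm sys) //.
  by rewrite -[E 0 *m P *m phi]mulmxA Pphi.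
- case=> [|[|i]] lt /=.
  + exact: dbl_new.
  + by apply: dbl_odd => //; rewrite mulmx1 mul1mx.
  + apply: dbl_even => //; [exact: Ephi | by rewrite (cs_anti sys) |].
    by apply: twist_comm => //; apply: (mo_eta mo).
- apply: dbl_frame_gram => //; first by apply: twistT; apply: mo_etaT mo.
  exact: eigen_orthogonal TG Tphi fT.
Qed.

Lemma hyp_model n N d k (A : nat -> 'M[R]_d) eta : model n N k A eta ->
  model n.+2 N.+2 (hyp_sign k) (hyp_gens A) (even_mx eta).
Proof.
move=> mo.
constructor.
- by rewrite !ltnS; apply: mo_le mo.
- by rewrite addn_gt0 (mo_gt0 mo).
- case=> [|[|i]] lt; [exact: rot_sq | by apply: odd_sq; rewrite mulmx1 |].
  by apply/even_sq/(mo_sq mo).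
- case=> [|[|i]] [|[|j]] lti ltj //= ij.
  + exact/anti_sym/odd_rot.
  + exact/anti_sym/even_rot.
  + exact: odd_rot.
  + by apply/anti_sym/even_odd_anti; rewrite mulmx1 mul1mx.
  + exact: even_rot.
  + by apply: even_odd_anti; rewrite mulmx1 mul1mx.
  + exact/even_anti/(mo_anti mo).
- case=> [|[|i]] lt; [exact: rot_T | by apply: odd_T; rewrite scale1r trmx1 |].
  exact/even_T/(mo_sym mo).
- by rewrite -[RHS]scale1r; apply: even_T; rewrite scale1r; apply: mo_etaT mo.
- by apply: even_sq; apply: mo_eta2 mo.
- case=> [|[|i]] lt; first exact: even_rot.
    by apply: even_odd_anti; rewrite mulmx1 mul1mx.
  exact/even_anti/(mo_eta mo).
- case=> [|[|i]] lt; first exact: rot_perm.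
    exact/odd_perm_mx/signed_perm1.
  exact/even_perm/(mo_perm mo).
- exact/even_diag/(mo_diag mo).
- exact: hyp_universal mo.
Qed.
End Hyperbolic.

(** * Multiplying four generators by their product *)

Section Quad.
Variable R : rcfType.

(** These indices are those of the generators of square opposite to the others
    after four hyperbolic pairs have been added. *)
Definition in_quad (i : nat) := i \in [:: 1; 3; 5; 7].
Definition quad m (E : nat -> 'M[R]_m) := (E 1 *m E 3) *m (E 5 *m E 7).
Definition quad_gens m (E : nat -> 'M[R]_m) i := if in_quad i then quad E *m E i else E i.
Definition quad_sign (k : nat -> R) i := if in_quad i then - k i else k i.

Lemma in_quad_lt n i : (7 < n)%N -> in_quad i -> (i < n)%N.
Proof. by move=> n7; rewrite /in_quad !inE => /or4P[] /eqP ->; apply: leq_trans n7. Qed.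

(** Sign rule: signs of commutation add up. *)
Lemma skewM m (b1 b2 : bool) (x y z : 'M[R]_m) :
  x *m z = (-1) ^+ b1 *: (z *m x) -> y *m z = (-1) ^+ b2 *: (z *m y) ->
  x *m y *m z = (-1) ^+ (b1 (+) b2) *: (z *m (x *m y)).
Proof.
move=> xz yz; rewrite -mulmxA yz -scalemxAr [x *m (z *m _)]mulmxA xz -scalemxAl scalerA mulrC.
by rewrite signr_addb -mulmxA.
Qed.

Section QuadTheory.
Variables (m n : nat) (E : nat -> 'M[R]_m).
Hypothesis n7 : (7 < n)%N.
Hypothesis anti : forall i j, (i < n)%N -> (j < n)%N -> i != j -> E i *m E j = - (E j *m E i).

Let lt i : in_quad i -> (i < n)%N := in_quad_lt n7.

(** The product of the four anticommutes with each of them, which commutes with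
    itself and anticommutes with three others, and commutes with any generator
    anticommuting with all four. *)
Lemma quad_comm i : (i < n)%N -> quad E *m E i = (-1) ^+ in_quad i *: (E i *m quad E).
Proof.
move=> ltin.
have H j : in_quad j -> E j *m E i = (-1) ^+ (j != i) *: (E i *m E j).
  case: eqVneq => [->|ji] jq; first by rewrite scale1r.
  by rewrite (anti (lt jq) ltin ji) scaleN1r.
rewrite (skewM (skewM (H 1 isT) (H 3 isT)) (skewM (H 5 isT) (H 7 isT))).
congr ((-1) ^+ _ *: _); case: (boolP (in_quad i)); rewrite /in_quad !inE.
  by case/or4P => /eqP ->.
by rewrite !negb_or => /and4P[]; rewrite ![i == _]eq_sym => -> -> -> ->.
Qed.

Lemma quad_even i : (i < n)%N -> ~~ in_quad i -> quad E *m E i = E i *m quad E.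
Proof. by move=> lti /negPf iq; rewrite quad_comm // iq scale1r. Qed.

Lemma quad_pairC : E 5 *m E 7 *m (E 1 *m E 3) = E 1 *m E 3 *m (E 5 *m E 7).
Proof.
have H j l : in_quad j -> in_quad l -> j != l -> E j *m E l = (-1) ^+ true *: (E l *m E j).
  by move=> jq lq jl; rewrite anti ?lt // scaleN1r.
rewrite mulmxA (skewM (H 5 1 isT isT isT) (H 7 1 isT isT isT)) scale1r -!mulmxA.
congr (_ *m _); rewrite !mulmxA.
by rewrite (skewM (H 5 3 isT isT isT) (H 7 3 isT isT isT)) scale1r !mulmxA.
Qed.

Lemma quad_adj (G : 'M[R]_m) s : s * s = 1 ->
  (forall i, in_quad i -> (E i)^T *m G = s *: (G *m E i)) -> (quad E)^T *m G = G *m quad E.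
Proof.
move=> ss adj.
have pair i j : in_quad i -> in_quad j -> i != j ->
    (E i *m E j)^T *m G = - (G *m (E i *m E j)).
  move=> iq jq ij; rewrite trmx_mul -mulmxA adj // -scalemxAr [_^T *m _]mulmxA adj // -scalemxAl.
  by rewrite scalerA ss scale1r -mulmxA [E j *m E i]anti ?lt 1?eq_sym // mulmxN.
rewrite {1}/quad trmx_mul -mulmxA pair // mulmxN [_^T *m _]mulmxA pair // mulNmx opprK -mulmxA.
by rewrite quad_pairC.
Qed.

Section QuadSquare.
Variable q : R.
Hypothesis (qq : q * q = 1) (sq : forall i, in_quad i -> E i *m E i = q%:M).

Lemma quad_sq : quad E *m quad E = 1%:M.
Proof.
have pair i j : in_quad i -> in_quad j -> i != j ->
    (E i *m E j) *m (E i *m E j) = - 1%:M.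
  move=> iq jq ij; rewrite mulmxA -[_ *m E j *m E i]mulmxA [E j *m E i]anti ?lt 1?eq_sym //.
  by rewrite mulmxN mulNmx mulmxA sq // -mulmxA sq // -scalar_mxM qq.
rewrite {1}/quad -quad_pairC /quad -mulmxA [E 1 *m _ *m (_ *m (_ *m _))]mulmxA pair //.
by rewrite mulNmx mul1mx mulmxN pair // opprK.
Qed.

Lemma quad_skew i : in_quad i -> E i *m quad E = - (quad E *m E i).
Proof. by move=> iq; rewrite quad_comm ?lt // iq scaleN1r opprK. Qed.

Lemma quad_gens_pair i j : in_quad i -> in_quad j ->
  quad_gens E i *m quad_gens E j = - (E i *m E j).
Proof.
move=> iq jq; rewrite /quad_gens iq jq mulmxA -[_ *m E i *m quad E]mulmxA quad_skew //.
by rewrite mulmxN mulNmx mulmxA quad_sq mul1mx.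
Qed.

Lemma quad_quad : quad (quad_gens E) = quad E.
Proof. by rewrite {1}/quad !quad_gens_pair // mulmxN mulNmx opprK. Qed.

Lemma quad_gensK i : quad_gens (quad_gens E) i = E i.
Proof.
rewrite /quad_gens -/(quad_gens E) quad_quad; case: ifP => iq; rewrite iq //.
by rewrite mulmxA quad_sq mul1mx.
Qed.

Lemma quad_gens_anti i j : (i < n)%N -> (j < n)%N -> i != j ->
  quad_gens E i *m quad_gens E j = - (quad_gens E j *m quad_gens E i).
Proof.
move=> lti ltj ij.
have [iq|iq] := boolP (in_quad i); have [jq|jq] := boolP (in_quad j).
- by rewrite !quad_gens_pair // anti.
- rewrite /quad_gens iq (negPf jq) -mulmxA [E i *m E j]anti // mulmxN.
  by rewrite [quad E *m (E j *m _)]mulmxA quad_even // -mulmxA.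
- rewrite /quad_gens jq (negPf iq) mulmxA -quad_even // -mulmxA [E i *m E j]anti //.
  by rewrite mulmxN mulmxA.
- by rewrite /quad_gens (negPf iq) (negPf jq) anti.
Qed.

Lemma quad_gens_sq i s : E i *m E i = s%:M ->
  quad_gens E i *m quad_gens E i = (if in_quad i then - s else s)%:M.
Proof.
move=> h; have [iq|iq] := boolP (in_quad i); last by rewrite /quad_gens (negPf iq).
by rewrite quad_gens_pair // h raddfN.
Qed.

End QuadSquare.
Lemma quad_gens_adj (G : 'M[R]_m) k i : (forall j, k j * k j = 1) ->
  (forall j l, in_quad j -> in_quad l -> k j = k l) ->
  (forall i, (i < n)%N -> (E i)^T *m G = k i *: (G *m E i)) -> (i < n)%N ->
  (quad_gens E i)^T *m G = quad_sign k i *: (G *m quad_gens E i).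
Proof.
move=> kk kq adj lti; rewrite /quad_gens /quad_sign.
have [iq|iq] := boolP (in_quad i); last exact: adj.
have quadG : (quad E)^T *m G = G *m quad E.
  by apply: (@quad_adj _ (k 1) (kk 1)) => j jq; rewrite adj ?lt // (kq j 1).
rewrite trmx_mul -mulmxA quadG mulmxA adj // -scalemxAl -mulmxA.
have -> : E i *m quad E = - (quad E *m E i).
  by rewrite quad_comm // iq scaleN1r opprK.
by rewrite mulmxN scalerN scaleNr.
Qed.
End QuadTheory.

(** In the operators as in the model, the transformation is an involution
    ([quad_gensK]).  A copy of the old model inside the transformed operators is
    a copy of the transformed model inside the original ones, because the
    product of four generators is the same expression in the A i and in the
    eta A i. *)
Lemma quad_universal n N d k (A : nat -> 'M[R]_d) eta : (7 < n)%N ->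
  (forall j, k j * k j = 1) -> (forall j l, in_quad j -> in_quad l -> k j = k l) ->
  model n N k A eta -> universal n (quad_sign k) (quad_gens A) eta.
Proof.
move=> n7 kk kq mo m c G P E c1 sys; have cc := sqr_sign c1.
have anti := cs_anti sys.
have sq i : in_quad i -> E i *m E i = (- (c * k 1))%:M.
  by move=> iq; rewrite (cs_sq sys) ?(in_quad_lt n7) // /quad_sign iq (kq i 1) // mulrN.
have qq : - (c * k 1) * - (c * k 1) = 1 by rewrite mulrNN mulrACA cc kk mulr1.
have Pquad : P *m quad E = quad E *m P.
  have comm i : in_quad i -> P *m E i = E i *m P.
    by move=> iq; rewrite (cs_comm sys) ?(in_quad_lt n7).
  by rewrite /quad; do !apply: comm_mxM; apply: comm.
have [|e [phi [e1 Pphi Ephi phiG]]] := @mo_univ _ _ _ _ _ _ _ mo m c G P (quad_gens E) c1.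
  constructor.
  - exact: cs_sym sys.
  - exact: cs_unit sys.
  - move=> i lt; rewrite (quad_gens_sq n7 anti qq sq (cs_sq sys lt)) /quad_sign.
    by case: ifP => iq; rewrite ?iq // mulrN opprK.
  - by move=> i j lti ltj ij; rewrite (quad_gens_anti n7 anti qq sq).
  - move=> i lt; rewrite (@quad_gens_adj _ _ _ n7 anti G (quad_sign k)) //.
    + by rewrite /quad_sign; case: ifP => iq; rewrite ?iq // opprK.
    + by move=> j; rewrite /quad_sign; case: ifP; rewrite ?mulrNN.
    + by move=> j l jq lq; rewrite /quad_sign jq lq (kq j l).
    + exact: cs_adj sys.
  - exact: cs_idem sys.
  - exact: cs_self sys.
  - move=> i lt; rewrite /quad_gens; case: ifP => iq; last exact: (cs_comm sys).
    by rewrite mulmxA Pquad -mulmxA (cs_comm sys) // mulmxA.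
  - exact: cs_neq0 sys.
exists e, phi; split=> // i lt.
set H := twist c eta in Ephi *.
have HH : H *m H = 1%:M by apply: twist_sq; apply: mo_eta2 mo.
have HA j : (j < n)%N -> H *m A j = c *: (A j *m H).
  by move=> ltj; apply: twist_comm => //; apply: mo_eta mo _ ltj.
have HA2 j l : (j < n)%N -> (l < n)%N -> H *m A j *m H *m A l = c *: (A j *m A l).
  move=> ltj ltl; rewrite HA // -!scalemxAl -[_ *m H *m H]mulmxA HH mulmx1 //.
have qA : quad (quad_gens E) *m phi = phi *m quad A.
  have two j l : in_quad j -> in_quad l ->
      quad_gens E j *m quad_gens E l *m phi = c *: (phi *m (A j *m A l)).
    move=> jq lq; rewrite -mulmxA Ephi ?(in_quad_lt n7) // mulmxA Ephi ?(in_quad_lt n7) //.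
    rewrite -mulmxA [H *m A j *m _]mulmxA HA2 -?scalemxAr //; exact: in_quad_lt.
  rewrite {1}/quad -[_ *m phi]mulmxA two // -scalemxAr [_ *m (phi *m _)]mulmxA two // -scalemxAl.
  by rewrite scalerA cc scale1r -mulmxA.
have HqA : quad A *m H = H *m quad A.
  have two j l : in_quad j -> in_quad l -> A j *m A l *m H = H *m (A j *m A l).
    move=> jq lq; rewrite mulmxA HA ?(in_quad_lt n7) // -scalemxAl -!mulmxA.
    by rewrite HA ?(in_quad_lt n7) // -scalemxAr scalerA cc scale1r.
  by rewrite /quad -mulmxA two // mulmxA two // -mulmxA.
rewrite -(quad_gensK n7 anti qq sq i) {1}/quad_gens [in RHS]/quad_gens; case: ifP => iq.
  by rewrite -mulmxA Ephi // [LHS]mulmxA qA -[LHS]mulmxA [quad A *m (H *m _)]mulmxA HqA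
    -[H *m quad A *m _]mulmxA.
exact: Ephi.
Qed.

Lemma quad_model n N d k (A : nat -> 'M[R]_d) eta : (7 < n)%N ->
  (forall j, k j * k j = 1) -> (forall j l, in_quad j -> in_quad l -> k j = k l) ->
  model n N k A eta -> model n N (quad_sign k) (quad_gens A) eta.
Proof.
move=> n7 kk kq mo; have nN := mo_le mo; have N7 := leq_trans n7 nN.
have anti := mo_anti mo.
have sq i : in_quad i -> A i *m A i = (k 1)%:M.
  by move=> iq; rewrite (mo_sq mo) ?(in_quad_lt N7) // (kq i 1).
constructor=> //.
- exact: mo_gt0 mo.
- by move=> i lt; rewrite (quad_gens_sq N7 anti (kk 1) sq (mo_sq mo lt)).
- by move=> i j lti ltj ij; rewrite (quad_gens_anti N7 anti (kk 1) sq).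
- move=> i lt; rewrite -[LHS]mulmx1 (@quad_gens_adj _ _ _ N7 anti _ k) ?mul1mx //.
  by move=> j ltj; rewrite mulmx1 mul1mx (mo_sym mo).
- exact: mo_etaT mo.
- exact: mo_eta2 mo.
- have two j l : in_quad j -> in_quad l -> eta *m (A j *m A l) = A j *m A l *m eta.
    move=> jq lq; rewrite mulmxA (mo_eta mo) ?(in_quad_lt n7) // mulNmx -mulmxA.
    by rewrite -[_ *m A l]mulmxA (mo_eta mo) ?(in_quad_lt n7) // mulmxN opprK mulmxA.
  have etaq : eta *m quad A = quad A *m eta by apply: comm_mxM; apply: two.
  move=> i lt; rewrite /quad_gens; case: ifP => iq; last exact: mo_eta mo _ lt.
  by rewrite mulmxA etaq -[LHS]mulmxA (mo_eta mo) // mulmxN mulmxA.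
- have perm i : in_quad i -> signed_perm (A i).
    by move=> iq; apply: (mo_perm mo); apply: in_quad_lt iq.
  move=> i lt; rewrite /quad_gens; case: ifP => iq; last exact: mo_perm mo _ lt.
  by rewrite /quad; do ![apply: signed_permM | apply: perm].
- exact: mo_diag mo.
- exact: quad_universal mo.
Qed.
End Quad.

(** * Models for all ranks congruent to 0, 1, 2 or 4 modulo 8 *)

Section Bases.
Variable R : rcfType.
Local Notation neg := (fun _ : nat => -1 : R).

(** Periodicity: four hyperbolic pairs bring four generators of square -1 and
    four of square 1; the latter are then multiplied by their product. *)
Lemma model_step8 n N d (A : nat -> 'M[R]_d) eta : model n N neg A eta ->
  exists d' (A' : nat -> 'M[R]_d') eta', model n.+2.+2.+4 N.+2.+2.+4 neg A' eta'.
Proof.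
do 4![move/hyp_model].
set B := hyp_gens _; set e := even_mx _; set k := hyp_sign _ => mo.
exists _, (quad_gens B), e.
have -> : neg = quad_sign k.
  by apply: funext; do 8?[case=> [|]] => // i; rewrite /quad_sign //= opprK.
apply: quad_model mo => //.
  by do 8?[case=> [|]] => * //=; rewrite ?mulrNN mulr1.
by move=> j l; rewrite /in_quad !inE => /or4P[] /eqP -> /or4P[] /eqP ->.
Qed.

Lemma model_family n N d (A : nat -> 'M[R]_d) eta q : model n N neg A eta ->
  exists d' (A' : nat -> 'M[R]_d') eta', model (q * 8 + n) (q * 8 + N) neg A' eta'.
Proof.
move=> mo; elim: q => [|q [d' [A' [eta' mo']]]]; first by exists d, A, eta.
exact: model_step8 mo'.
Qed.

Lemma model0 : model 0 0 neg (fun=> 0 : 'M[R]_1) 1%:M.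
Proof.
constructor=> //.
- by rewrite trmx1.
- by rewrite mulmx1.
- by move=> j; exists false; rewrite col1 scale1r.
move=> m c G P E c1 sys.
have [e [v [e1 Pv vG]]] :=
  unit_vector (cs_sym sys) (cs_unit sys) (cs_idem sys) (cs_self sys) (cs_neq0 sys).
exists e, v; split=> //.
by rewrite vG /twist; case: ifP; rewrite scalemx1.
Qed.

Lemma skew_compress m d (G f : 'M[R]_m) (phi : 'M[R]_(m, d)) : G^T = G ->
  f^T *m G = - (G *m f) -> (phi^T *m G *m f *m phi)^T = - (phi^T *m G *m f *m phi).
Proof.
move=> GT fG; rewrite !trmx_mul trmxK GT -!mulmxA [f^T *m _]mulmxA fG mulNmx mulmxN.
by rewrite !mulmxA.
Qed.

(** v and its image by a skew operator are orthogonal. *)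
Lemma model1 : model 1 1 neg (fun=> rot_mx R 1) (even_mx 1%:M).
Proof.
constructor=> //.
- by move=> i _; apply: rot_sq.
- by case=> [|i] // [|j].
- by move=> i _; apply: rot_T.
- by rewrite -[RHS]scale1r; apply: even_T; rewrite scale1r trmx1.
- by apply: even_sq; rewrite mulmx1.
- by move=> i _; apply: even_rot.
- by move=> i _; apply: rot_perm.
- exact/even_diag/signed_diag1.
move=> m c G P E c1 sys; have cc := sqr_sign c1.
have [e [v [e1 Pv vG]]] :=
  unit_vector (cs_sym sys) (cs_unit sys) (cs_idem sys) (cs_self sys) (cs_neq0 sys).
have fG : (E 0)^T *m G = - (G *m E 0) by rewrite (cs_adj sys) // scaleN1r.
have ff : E 0 *m E 0 = (- c)%:M by rewrite (cs_sq sys) // mulrN1.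
have H1 : twist c (1%:M : 'M[R]_1) = 1%:M by rewrite /twist; case: ifP.
exists e, (dbl_frame c (E 0) v 1%:M); rewrite twist_dbl // H1; split=> //.
- rewrite mul_mx_row Pv -scalemxAr !mulmxA (cs_comm sys) //.
  by rewrite -[E 0 *m P *m v]mulmxA Pv.
- by case=> // _; apply: dbl_new; rewrite ?mulmx1.
- apply: dbl_frame_gram; rewrite ?mulmx1 ?trmx1 ?vG ?scalemx1 //.
  apply: mx_eqN0; rewrite -(skew_compress _ (cs_sym sys) fG).
  by rewrite [RHS]mx11_tr.
Qed.

(** The units i, j and, up to sign, k of the quaternions. *)
Definition quaternion_gens (i : nat) : 'M[R]_(1 + 1 + (1 + 1)) :=
  match i with 0 => even_mx (rot_mx R 1) | 1 => rot_mx R _ | _ => odd_mx (rot_mx R 1) end.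

(** A vector v is orthogonal to its images by the skew operators E 0, E 1 and
    E 1 E 0; hence the copy of the complex plane spanned by v and E 0 v is
    orthogonal to its image by E 1. *)
Lemma model2 : model 2 3 neg quaternion_gens (even_mx (even_mx 1%:M)).
Proof.
have mo := model1; have II := rot_sq R 1; have TI := rot_T R 1.
constructor=> //.
- by case=> [|[|[|i]]] // _; [apply: even_sq | apply: rot_sq | apply: odd_sq].
- have comm := erefl (rot_mx R 1 *m rot_mx R 1).
  case=> [|[|[|i]]] // [|[|[|j]]] // _ _ _.
  + exact: even_rot.
  + exact: even_odd_anti.
  + exact/anti_sym/even_rot.
  + exact/anti_sym/odd_rot.
  + exact/anti_sym/even_odd_anti.
  + exact: odd_rot.
- by case=> [|[|[|i]]] // _; [apply: even_T | apply: rot_T | apply: odd_T].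
- by rewrite -[RHS]scale1r; apply: even_T; rewrite scale1r; apply: mo_etaT mo.
- by apply: even_sq; apply: mo_eta2 mo.
- case=> [|[|i]] // _; last exact: even_rot.
  by apply: even_anti; exact: even_rot.
- case=> [|[|i]] // _; [apply: even_perm|]; exact: rot_perm.
- exact/even_diag/(mo_diag mo).
move=> m c G P E c1 sys; have cc := sqr_sign c1.
have [|e [phi [e1 Pphi Ephi phiG]]] := @mo_univ _ _ _ _ _ _ _ mo m c G P E c1.
  constructor; try by case: sys.
  - by move=> i lt; apply: (cs_sq sys); apply: ltnW.
  - by move=> i j lti ltj; apply: (cs_anti sys); apply: ltnW.
  - by move=> i lt; apply: (cs_adj sys); apply: ltnW.
  - by move=> i lt; apply: (cs_comm sys); apply: ltnW.
have fG : (E 1)^T *m G = - (G *m E 1) by rewrite (cs_adj sys) // scaleN1r.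
have ff : E 1 *m E 1 = (- c)%:M by rewrite (cs_sq sys) // mulrN1.
set H := twist c _ in Ephi phiG.
have HH : H *m H = 1%:M by apply: twist_sq; apply: mo_eta2 mo.
have HT : H^T = H by apply: twistT; apply: mo_etaT mo.
exists e, (dbl_frame c (E 1) phi H); rewrite twist_dbl // -/H; split=> //.
- rewrite mul_mx_row Pphi -scalemxAr !mulmxA (cs_comm sys) //.
  by rewrite -[E 1 *m P *m phi]mulmxA Pphi.
- case=> [|[|i]] // _; last exact: dbl_new.
  apply: dbl_even => //; [exact: (Ephi 0) | by rewrite (cs_anti sys) |].
  by apply: twist_comm => //; exact: even_rot.
- apply: dbl_frame_gram => //.
  set X := phi^T *m G *m E 1 *m phi.
  have XT : X^T = - X by apply: skew_compress; first exact: cs_sym sys.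
  set B := H *m rot_mx R 1.
  have fG0 : (E 0)^T *m G = - (G *m E 0) by rewrite (cs_adj sys) // scaleN1r.
  (* X is skew, and this relation forces its off-diagonal entry to vanish too. *)
  have XB : X *m B = B^T *m X.
    have <- : phi^T *m G *m E 1 *m (E 0 *m phi) = X *m B by rewrite (Ephi 0) // mulmxA.
    have <- : (E 0 *m phi)^T *m G *m E 1 *m phi = B^T *m X.
      by rewrite (Ephi 0) // trmx_mul !mulmxA.
    rewrite trmx_mul -[phi^T *m (E 0)^T *m G]mulmxA fG0 mulmxN !mulNmx !mulmxA.
    rewrite -[_ *m E 1 *m E 0]mulmxA [E 1 *m E 0](cs_anti sys) // mulmxN mulNmx.
    by rewrite !mulmxA.
  have [s [s0 Bs]] : exists s, s != 0 /\ B = block_mx 0 (- 1%:M) s%:M 0.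
    rewrite /B /H /twist; case: ifP => _.
      by exists 1; rewrite oner_eq0 mul1mx.
    by exists (-1); rewrite oppr_eq0 oner_eq0 /even_mx /rot_mx !blockE raddfN.
  move: XT XB; rewrite Bs -[X]submxK tr_block_mx opp_block_mx !blockE => /eq_block_mx[aN bN _ dN].
  rewrite !mx11_tr in aN bN dN; rewrite bN !tr_scalar_mx.
  rewrite !mul_mx_scalar !mul_scalar_mx => /eq_block_mx[/(congr1 (fun Y => s^-1 *: Y))].
  rewrite !scalerA mulVf // !scale1r => bc _ _ _.
  by rewrite (mx_eqN0 aN) (mx_eqN0 dN) (mx_eqN0 bc) oppr0 -block_mx0.
Qed.

(** Four generators of square -c act on a sum of two spaces on which their
    product T is 1 and -1.  The first space is a quaternionic module, with units
    c E 0 E 1 and c E 0 E 2, and E 0 sends it to the second.  When A 0, A 1, A 2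
    are i, j, -k, the first four matrices below are the generators; the others,
    built from three matrices B commuting with the quaternions, anticommute with
    the first four. *)
Definition quat_gens d (A B : nat -> 'M[R]_d) i : 'M[R]_(d + d) :=
  if i is j.+1 then if (j < 3)%N then odd_mx (- A j) else even_mx (B (j - 3)%N) else rot_mx R d.

Lemma quat_universal N d (A B : nat -> 'M[R]_d) eta : (2 < N)%N -> A 2 = - (A 0 *m A 1) ->
  model 2 N neg A eta -> universal 4 neg (quat_gens A B) (even_mx 1%:M).
Proof.
move=> N2 A2 mo m c G P E c1 sys; have cc := sqr_sign c1.
have sq i : (i < 4)%N -> E i *m E i = (- c)%:M by move=> lt; rewrite (cs_sq sys) // mulrN1.
have adj i : (i < 4)%N -> (E i)^T *m G = - (G *m E i).
  by move=> lt; rewrite (cs_adj sys) // scaleN1r.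
have anti := cs_anti sys; have comm := cs_comm sys.
(* E is reindexed so that [quad F] is the product of its four members. *)
pose F i := if in_quad i then E i./2 else 0.
have lt4 i : in_quad i -> (i./2 < 4)%N by rewrite /in_quad !inE => /or4P[] /eqP ->.
have antiF i j : (i < 8)%N -> (j < 8)%N -> i != j -> F i *m F j = - (F j *m F i).
  move=> _ _ ij; rewrite /F; case: ifP => iq; case: ifP => jq; rewrite ?mul0mx ?mulmx0 ?oppr0 //.
  rewrite anti ?lt4 //; move: iq jq ij; rewrite /in_quad !inE.
  by move=> /or4P[] /eqP -> /or4P[] /eqP ->.
have sqF i : in_quad i -> F i *m F i = (- c)%:M by move=> iq; rewrite /F iq sq ?lt4.
have ccN : - c * - c = 1 by rewrite mulrNN.
pose T := quad F.
have TT : T *m T = 1%:M by apply: (quad_sq _ antiF ccN sqF).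
have TG : T^T *m G = G *m T.
  apply: (quad_adj _ antiF (s := -1)) => //; first by rewrite mulrNN mulr1.
  by move=> i iq; rewrite /F iq adj ?lt4 // scaleN1r.
have fT i : (i < 4)%N -> E i *m T = - (T *m E i).
  move=> lt; have iq : in_quad i.*2.+1 by case: i lt => [|[|[|[|i]]]].
  have := quad_skew (isT : 7 < 8)%N antiF iq.
  by rewrite /F iq /= uphalf_double.
have PT : P *m T = T *m P.
  have commF i : in_quad i -> comm_mx P (F i) by move=> iq; rewrite /F iq; apply/comm/lt4.
  by apply: comm_mxM; apply: comm_mxM; apply: commF.
have pairT i j : (i < 4)%N -> (j < 4)%N -> T *m (E i *m E j) = E i *m E j *m T.
  move=> li lj; rewrite mulmxA -[T *m E i]opprK -fT // mulNmx.
  by rewrite -[E i *m T *m _]mulmxA -[E i *m E j *m T]mulmxA fT // mulmxN.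
have pairG i j : (i < 4)%N -> (j < 4)%N -> i != j -> (E i *m E j)^T *m G = - (G *m (E i *m E j)).
  move=> li lj ij; rewrite trmx_mul -mulmxA adj // mulmxN [_^T *m (_ *m _)]mulmxA adj // mulNmx
    opprK.
  by rewrite -mulmxA [E j *m _]anti 1?eq_sym // mulmxN.
have pairM i j l : (i < 4)%N -> (j < 4)%N -> i != j -> (E i *m E j) *m (E i *m E l) = c *:
  (E j *m E l).
  move=> li lj ij; rewrite mulmxA -[_ *m E j *m E i]mulmxA [E j *m E i]anti 1?eq_sym //.
  by rewrite mulmxN mulmxA sq // mulNmx mul_scalar_mx -scalemxAl scaleNr opprK.
pose E' i := c *: (E 0 *m E (if i is 0 then 1 else 2)).
have [||e [phi [e1 Pphi Ephi phiG]]] :=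
    @mo_univ _ _ _ _ _ _ _ mo m 1 G (split_proj P T) E'.
- by left.
- have PP := cs_idem sys; have PG := cs_self sys.
  constructor.
  + exact: cs_sym sys.
  + exact: cs_unit sys.
  + by case=> [|[|i]] // _; rewrite /E' -scalemxAr -scalemxAl scalerA cc scale1r pairM // sq //
       scale_scalar_mx mulrN cc mul1r.
  + case=> [|[|i]] [|[|j]] // _ _ _; rewrite /E' -!scalemxAr -!scalemxAl !scalerA cc !scale1r
    !pairM //.
      by rewrite [E 1 *m _]anti // scalerN.
    by rewrite [E 2 *m _]anti // scalerN.
  + by case=> [|[|i]] // _; rewrite /E' linearZ /= -scalemxAl pairG // scalerN scaleN1r scalemxAr.
  + exact: split_proj_idem.
  + exact: split_proj_self.
  + have commE' j : (0 < j < 4)%N -> split_proj P T *m (c *: (E 0 *m E j)) = c *: (E 0 *m E j)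
    *m split_proj P T.
      case/andP=> _ lj; rewrite -scalemxAr -scalemxAl; congr (_ *: _).
      apply: split_proj_comm; last exact: pairT.
      by apply: comm_mxM; apply: comm.
    by case=> [|[|i]] // _; apply: commE'.
  + apply: (@split_proj_neq0 _ _ P T PT (E 0) (- c)) => //; last exact: cs_neq0 sys.
    * by rewrite oppr_eq0; case: c1 => ->; rewrite ?oppr_eq0 oner_eq0.
    * exact: sq.
    * exact: comm.
    * exact: fT.
have [Tphi {}Pphi] := split_proj_fix (cs_idem sys) TT PT Pphi.
rewrite /twist eqxx in Ephi phiG.
have E12 i : (i < 2)%N -> E i.+1 *m phi = E 0 *m phi *m (- A i).
  move=> lt; have := Ephi i lt; rewrite mul1mx mulmxN -[E 0 *m phi *m _]mulmxA => <-.
  rewrite /E'; have -> : (if i is 0 then 1%N else 2%N) = i.+1 by case: i lt => [|[|i]].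
  by rewrite -scalemxAl -scalemxAr !mulmxA sq // mul_scalar_mx -scalemxAl scalerA mulrN cc
    scaleN1r opprK.
have A00 : A 0 *m A 0 = (-1)%:M by rewrite (mo_sq mo) //; apply: ltn_trans N2.
have E3 : E 3 *m phi = E 0 *m phi *m (- A 2).
  have phiA : E 0 *m E 1 *m phi = c *: (phi *m A 0).
    by have := Ephi 0 isT; rewrite mul1mx => <-; rewrite /E' -scalemxAl scalerA cc scale1r.
  have : E 2 *m E 3 *m (E 0 *m E 1 *m phi) = phi.
    by rewrite mulmxA -[RHS]Tphi; congr (_ *m _); exact: (quad_pairC (isT : 7 < 8)%N antiF).
  rewrite phiA -scalemxAr => /(congr1 (fun X => X *m A 0)).
  rewrite -scalemxAl !mulmxA -[_ *m A 0 *m A 0]mulmxA A00 mul_mx_scalar scaleN1r.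
  move/(congr1 (fun X => E 2 *m X)); rewrite -scalemxAr mulmxN !mulmxA sq // mul_scalar_mx.
  rewrite -!scalemxAl scalerN scalerA mulrN cc scaleN1r opprK => ->.
  rewrite (E12 1) // A2 opprK -mulmxA mulNmx (mo_anti mo) ?opprK //; exact: ltn_trans N2.
exists e, (dbl_frame c (E 0) phi 1%:M); rewrite twist_dbl //.
have -> : twist c (1%:M : 'M[R]_d) = 1%:M by rewrite /twist; case: ifP.
split=> //.
- rewrite mul_mx_row Pphi -scalemxAr !mulmxA mulmx1 comm //.
  by rewrite -[E 0 *m P *m phi]mulmxA Pphi /dbl_frame mulmx1.
- case=> [|i] lt; first by apply: dbl_new; rewrite ?mulmx1 ?sq.
  rewrite /quat_gens (lt : (i < 3)%N); apply: dbl_odd; rewrite ?mulmx1 ?mul1mx ?sq //;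
    last exact: anti.
  by case: i lt => [|[|[|i]]] // lt; rewrite ?E12 // E3.
- apply: dbl_frame_gram; rewrite ?mulmx1 ?trmx1 ?sq ?adj //.
  exact: eigen_orthogonal TG Tphi (fT 0 isT).
Qed.


Lemma quat_model N d (A B : nat -> 'M[R]_d) eta : (2 < N)%N -> A 2 = - (A 0 *m A 1) ->
  model 2 N neg A eta ->
  (forall i, (i < 3)%N -> B i *m B i = (-1)%:M) ->
  (forall i j, (i < 3)%N -> (j < 3)%N -> i != j -> B i *m B j = - (B j *m B i)) ->
  (forall i, (i < 3)%N -> (B i)^T = -1 *: B i) ->
  (forall i j, (i < 3)%N -> (j < 3)%N -> B i *m A j = A j *m B i) ->
  model 4 7 neg (quat_gens A B) (even_mx 1%:M).
Proof.
move=> N2 A2 mo BB Banti BT BA.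
have lt3 i : (i < 3)%N -> (i < N)%N by move=> i3; apply: leq_trans N2.
have sub7 i : ~~ (i < 3)%N -> (i < 6)%N -> (i - 3 < 3)%N by case: i => [|[|[|[|[|[|i]]]]]].
have odd_even_A i j : (i < 3)%N -> (j < 3)%N ->
    even_mx (B j) *m odd_mx (- A i) = - (odd_mx (- A i) *m even_mx (B j)).
  by move=> i3 j3; apply: even_odd_anti; rewrite mulmxN mulNmx BA.
constructor=> //.
- by rewrite addn_gt0 (mo_gt0 mo).
- case=> [|i] i7 /=; first exact: rot_sq.
  case: (boolP (i < 3)%N) => i3; last by apply/even_sq/BB/sub7.
  by apply: odd_sq; rewrite mulNmx mulmxN opprK (mo_sq mo) ?lt3.
- case=> [|i] [|j] //= i7 j7 ij.
  + apply: anti_sym; case: ifP => _; [exact: odd_rot | exact: even_rot].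
  + case: ifP => _; [exact: odd_rot | exact: even_rot].
  have {}ij : i != j by [].
  case: (boolP (i < 3)%N) => i3; case: (boolP (j < 3)%N) => j3.
  + by apply: odd_anti; rewrite !mulNmx !mulmxN !opprK (mo_anti mo) ?lt3.
  + by apply/anti_sym/odd_even_A => //; apply: sub7.
  + by apply/odd_even_A => //; apply: sub7.
  + apply/even_anti/Banti; rewrite ?sub7 //.
    by apply: contraNneq ij => h; rewrite -[i](@subnK 3) 1?leqNgt // h subnK // leqNgt.
- case=> [|i] i7 /=; first exact: rot_T.
  case: (boolP (i < 3)%N) => i3; last by apply/even_T/BT/sub7.
  by apply: odd_T; rewrite linearN /= (mo_sym mo) ?lt3 // scalerN.
- by rewrite -[RHS]scale1r; apply: even_T; rewrite scale1r trmx1.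
- by apply: even_sq; rewrite mulmx1.
- case=> [|i] i4; first exact: even_rot.
  by rewrite /quat_gens (i4 : (i < 3)%N); apply: even_odd_anti; rewrite mul1mx mulmx1.
- case=> [|i] i4; first exact: rot_perm.
  rewrite /quat_gens (i4 : (i < 3)%N); apply/odd_perm_mx/signed_permN.
  case: i i4 => [|[|[|i]]] // _; first exact: mo_perm mo 0 isT.
    exact: mo_perm mo 1 isT.
  rewrite A2; apply: signed_permN; apply: signed_permM; exact: (mo_perm mo).
- exact/even_diag/signed_diag1.
- exact: quat_universal mo.
Qed.


(** Right multiplications by the quaternions, commuting with the left ones. *)
Section Right.
Variables (d : nat) (I X : 'M[R]_d).
Hypotheses (II : I *m I = (-1)%:M) (XX : X *m X = 1%:M) (XI : X *m I = - (I *m X)).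
Hypotheses (TI : I^T = - I) (TX : X^T = X).
Let K := I *m X.

Definition right_gens i : 'M[R]_(d + d) :=
  match i with
  | 0 => block_mx I 0 0 I
  | 1 => block_mx 0 (- X) X 0
  | _ => block_mx 0 (- K) K 0
  end.

Let rel : (I *m X = K) * (X *m I = - K) * (I *m K = - X) * (K *m I = X) * (X *m K = - I) *
  (K *m X = I) * (K *m K = 1%:M) * (K^T = K) * (I *m I = - 1%:M).
Proof.
have II' : I *m I = - 1%:M by rewrite II raddfN.
do ![split] => //; rewrite /K.
- by rewrite mulmxA II' mulNmx mul1mx.
- by rewrite -mulmxA XI mulmxN mulmxA II' mulNmx mul1mx opprK.
- by rewrite mulmxA XI mulNmx -mulmxA XX mulmx1.
- by rewrite -mulmxA XX mulmx1.
- by rewrite mulmxA -[I *m X *m I]mulmxA XI mulmxN mulmxA II' !mulNmx mul1mx opprK XX.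
- by rewrite trmx_mul TI TX mulmxN XI opprK.
Qed.

Lemma right_gens_sq i : (i < 3)%N -> right_gens i *m right_gens i = (-1)%:M.
Proof.
case: i => [|[|[|i]]] // _; rewrite /right_gens !(blockE, rel, XX) ?[RHS]scalar_mx_block ?raddfN //.
Qed.

Lemma right_gens_anti i j : (i < 3)%N -> (j < 3)%N -> i != j ->
  right_gens i *m right_gens j = - (right_gens j *m right_gens i).
Proof.
by case: i => [|[|[|i]]] //; case: j => [|[|[|j]]] // _ _ _; rewrite /right_gens !(blockE, rel).
Qed.

Lemma right_gens_T i : (i < 3)%N -> (right_gens i)^T = -1 *: right_gens i.
Proof.
by case: i => [|[|[|i]]] // _; rewrite /right_gens !blockE ?linearN /= ?rel ?TI ?TX.
Qed.

Lemma right_gens_comm i : (i < 3)%N -> [/\ right_gens i *m even_mx I = even_mx I *m right_gens i,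
  right_gens i *m rot_mx R d = rot_mx R d *m right_gens i & right_gens i *m odd_mx I = odd_mx I
    *m right_gens i].
Proof.
by case: i => [|[|[|i]]] // _; split; rewrite /right_gens /even_mx /odd_mx /rot_mx !(blockE, rel).
Qed.
End Right.

Lemma model4 : exists A : nat -> 'M[R]_(1 + 1 + (1 + 1) + (1 + 1 + (1 + 1))),
  model 4 7 neg A (even_mx 1%:M).
Proof.
have II := rot_sq R 1; have TI : (rot_mx R 1)^T = - rot_mx R 1 by rewrite rot_T scaleN1r.
have XX : odd_mx 1%:M *m odd_mx 1%:M = 1%:M :> 'M[R]_(1 + 1) by apply: odd_sq; rewrite mulmx1.
have TX : (odd_mx 1%:M)^T = odd_mx 1%:M :> 'M[R]_(1 + 1).
  by rewrite -[RHS]scale1r; apply: odd_T; rewrite trmx1 scale1r.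
have XI := @odd_rot R 1 1%:M.
exists (quat_gens quaternion_gens (right_gens (rot_mx R 1) (odd_mx 1%:M))).
apply: quat_model model2 _ _ _ _ => //.
- by rewrite /= even_rot opprK /rot_mx /odd_mx /even_mx !blockE.
- exact: right_gens_sq.
- exact: right_gens_anti.
- exact: right_gens_T.
- move=> i j i3; have [c0 c1 c2] := right_gens_comm II XX XI TI TX i3.
  by case: j => [|[|[|j]]].
Qed.
End Bases.
(** * Admissible modules from matrices *)

Section ToAdmissible.
Variables (R : realType) (r s d : nat) (c : R) (A : nat -> 'M[R]_d) (B : 'M[R]_d).
Hypothesis hc : forall k : 'I_(r + s),
  pseudo_dot (delta_mx 0 k) (delta_mx 0 k : 'rV[R]_(r + s)) = c.
Hypotheses (BT : B^T = B) (Bu : B \in unitmx) (d0 : (0 < d)%N).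
Hypothesis Asq : forall i, (i < r + s)%N -> A i *m A i = (- c)%:M.
Hypothesis Aanti : forall i j,
  (i < r + s)%N -> (j < r + s)%N -> i != j -> A i *m A j = - (A j *m A i).
Hypothesis Aadj : forall i, (i < r + s)%N -> (A i)^T *m B = - (B *m A i).

Definition lin_gens (Z : 'rV[R]_(r + s)) : 'M[R]_d := \sum_k Z 0 k *: A k.

Lemma lin_gensD Z W : lin_gens (Z + W) = lin_gens Z + lin_gens W.
Proof. by rewrite -big_split; apply: eq_bigr => k _; rewrite mxE scalerDl. Qed.

Lemma lin_gensZ a Z : lin_gens (a *: Z) = a *: lin_gens Z.
Proof. by rewrite scaler_sumr; apply: eq_bigr => k _; rewrite mxE scalerA. Qed.

Lemma lin_gens_sq Z : lin_gens Z *m lin_gens Z = (- pseudo_dot Z Z)%:M.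
Proof.
have E : lin_gens Z *m lin_gens Z = \sum_k \sum_l (Z 0 k * Z 0 l) *: (A k *m A l).
  rewrite mulmx_suml; apply: eq_bigr => k _; rewrite mulmx_sumr; apply: eq_bigr => l _.
  by rewrite -scalemxAl -scalemxAr scalerA.
apply: (@scalerI R _ 2); first by rewrite pnatr_eq0.
rewrite scaler_nat mulr2n {1}E E [X in X + _]exchange_big -big_split /=.
rewrite pseudo_dotE -sumrN raddf_sum scaler_sumr; apply: eq_bigr => k _.
rewrite -big_split /= (bigD1 k) //= big1 ?addr0 => [|l lk]; last first.
  by rewrite [A l *m A k]Aanti ?ltn_ord // scalerN mulrC addNr.
rewrite Asq ?ltn_ord // -mulr2n -scaler_nat hc scale_scalar_mx.
by congr (_ *: _%:M); rewrite mulrN mulrCA mulrC [Z 0 k * _]mulrC.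
Qed.

Lemma lin_gens_adj Z : (lin_gens Z)^T *m B = - (B *m lin_gens Z).
Proof.
rewrite /lin_gens linear_sum mulmx_suml mulmx_sumr -sumrN; apply: eq_bigr => k _.
by rewrite linearZ /= -scalemxAl Aadj ?ltn_ord // -scalemxAr scalerN.
Qed.

Definition eval_mx (x : clifford R r s) : 'M[R]_d := cterm_eval lin_gens (cl_repr x).

Lemma eval_mx_class t : eval_mx (cl_class t) = cterm_eval lin_gens t.
Proof.
apply: cterm_eval_eq (cl_repr_class t); [exact: lin_gensD | exact: lin_gensZ | exact: lin_gens_sq].
Qed.

Lemma exists_admissible : exists X : admissible R r s, \dim {:X} = d.
Proof.
pose F (x : clifford R r s) : 'End('cV[R]_d) := linfun (mulmx (eval_mx x)).
have FE x v : F x v = eval_mx x *m v by rewrite lfunE.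
have lin : linear F.
  move=> a x y; apply/lfunP => v.
  rewrite add_lfunE scale_lfunE !FE scalemxAl -mulmxDl; congr (_ *m _).
  by rewrite -{1}[x]cl_reprK -{1}[y]cl_reprK [_ *: _]cl_scaleE [_ + _]cl_addE eval_mx_class.
pose FL : {linear clifford R r s -> 'End('cV[R]_d)} := HB.pack F
  (GRing.isLinear.Build R _ _ _ F lin).
have FL1 : FL 1 = \1%VF.
  by apply/lfunP => v; rewrite FE id_lfunE eval_mx_class mul1mx.
have FLM x y : FL (x * y) = (FL x \o FL y)%VF.
  apply/lfunP => v; rewrite comp_lfunE !FE mulmxA; congr (_ *m _).
  by rewrite -{1}[x]cl_reprK -{1}[y]cl_reprK [_ * _]cl_mulE eval_mx_class.
pose f (u v : 'cV[R]_d) : R := (u^T *m B *m v) 0 0.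
have fl : bilinear_for (GRing.Scale.Law.clone _ _ *%R _) (GRing.Scale.Law.clone _ _ (idfun \;
  *%R) _) f.
  split=> [v|u] a x y; rewrite /f /=.
    by rewrite [(_ + _)^T]linearP /= !mulmxDl -!scalemxAl !mxE.
  by rewrite mulmxDr -scalemxAr !mxE.
have fs u v : f u v = (-1) ^+ false * idfun (f v u).
  by rewrite expr0 mul1r /f /= -[u^T *m B *m v]mx11_tr !trmx_mul trmxK BT mulmxA.
pose fh : {symmetric 'cV[R]_d} := HB.pack f
  (bilinear_isBilinear.Build R _ _ _ _ _ f fl) (isHermitianSesquilinear.Build R _ false idfun f fs).
pose rho := CliffordRepr FL1 FLM.
have nd : nondegenerate fh.
  rewrite /nondegenerate -subv0; apply/subvP => u /mem_orthovP h; rewrite memv0.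
  suff uB : u^T *m B = 0 by rewrite -[u]trmxK -[u^T](mulmxK Bu) uB mul0mx trmx0.
  by apply/rowP => j; have := h (delta_mx j 0) (memvf _); rewrite /= /f -colE !mxE.
have dimd : \dim {:'cV[R]_d} = d by rewrite dimvf dim_matrix; exact: muln1.
have n0 : (0 < \dim {:'cV[R]_d})%N by rewrite dimd.
have sk Z (v w : 'cV[R]_d) : fh (rho (cl_gen Z) v) w = - fh v (rho (cl_gen Z) w).
  rewrite /fh /rho /= !FE /f eval_mx_class /= trmx_mul -[v^T *m _ *m B]mulmxA lin_gens_adj.
  by rewrite mulmxN mulNmx mxE !mulmxA.
by exists (Admissible n0 nd sk); exact: dimd.
Qed.
End ToAdmissible.

(** * Matrices of an admissible module *)

Section Coordinates.
Variable R : realType.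

Section Vector.
Variable V : vectType R.

Definition coo (v : V) : 'cV[R]_(dim V) := (v2r v)^T.
Definition vec (x : 'cV[R]_(dim V)) : V := r2v x^T.

Lemma cooK : cancel coo vec.
Proof. by move=> v; rewrite /vec trmxK v2rK. Qed.

Lemma vecK : cancel vec coo.
Proof. by move=> v; rewrite /coo r2vK trmxK. Qed.

Lemma coo_linear : linear coo.
Proof. by move=> a u v; rewrite /coo !linearP. Qed.

Lemma vec_linear : linear vec.
Proof. by move=> a u v; rewrite /vec !linearP. Qed.

HB.instance Definition _ := GRing.isLinear.Build R V 'cV[R]_(dim V) _ coo coo_linear.
HB.instance Definition _ := GRing.isLinear.Build R 'cV[R]_(dim V) V _ vec vec_linear.

Lemma vec_sum x : vec x = \sum_i x i 0 *: vec (delta_mx i 0).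
Proof. by rewrite {1}[x]cV_sum_delta linear_sum; apply: eq_bigr => i _; rewrite linearZ. Qed.
End Vector.

Definition map_matrix (V W : vectType R) (F : V -> W) : 'M[R]_(dim W, dim V) :=
  \matrix_(i, j) coo (F (vec (delta_mx j 0))) i 0.

Lemma map_matrixE (V W : vectType R) (F : {linear V -> W}) v : coo (F v) = map_matrix F *m coo v.
Proof.
rewrite -{1}[v]cooK vec_sum !linear_sum; apply/colP => i.
rewrite summxE mxE; apply: eq_bigr => j _; rewrite 2!linearZ mxE mulrC.
by rewrite [in RHS]mxE.
Qed.

End Coordinates.

Section FromAdmissible.
Variables (R : realType) (r s : nat) (c : R) (X : admissible R r s).
Hypothesis hc : forall k : 'I_(r + s),
  pseudo_dot (delta_mx 0 k) (delta_mx 0 k : 'rV[R]_(r + s)) = c.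
Local Notation m := (dim X).

Definition gram : 'M[R]_m :=
  \matrix_(i, j) adm_form X (vec (delta_mx i 0)) (vec (delta_mx j 0)).

Lemma gramE v w : adm_form X v w = ((coo v)^T *m gram *m coo w) 0 0.
Proof.
rewrite -{1}[v]cooK -{1}[w]cooK !vec_sum linear_sumlz -mulmxA mxE; apply: eq_bigr => i _.
rewrite linearZl_LR linear_sumr [in RHS]mxE; congr (_ * _); rewrite mxE; apply: eq_bigr => j _.
by rewrite linearZr_LR [gram i j]mxE mulrC.
Qed.

Lemma gram_sym : gram^T = gram.
Proof. by apply/matrixP=> i j; rewrite !mxE (hermitian_subproof _ (vec _)) /= expr0 mul1r. Qed.

Lemma gram_unit : gram \in unitmx.
Proof.
rewrite -row_free_unit -kermx_eq0; apply/eqP/row_matrixP => i; rewrite row0.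
set u := row i _; have uG : u *m gram = 0 by rewrite -row_mul mulmx_ker row0.
have : vec u^T \in orthov (adm_form X) fullv.
  by apply/mem_orthovP => w _; rewrite gramE vecK trmxK uG mul0mx mxE.
have /eqP -> := adm_nondeg X; rewrite memv0 => /eqP /(congr1 (@coo R X)).
by rewrite vecK linear0 => /(congr1 trmx); rewrite trmxK trmx0.
Qed.

Definition act (Z : 'rV[R]_(r + s)) : 'M[R]_m := map_matrix (adm_repr X (cl_gen Z)).

Lemma actE Z v : coo (adm_repr X (cl_gen Z) v) = act Z *m coo v.
Proof. exact: map_matrixE. Qed.

Lemma actD Z W : act (Z + W) = act Z + act W.
Proof.
by apply: mx_eqP => x; rewrite -[x]vecK -actE mulmxDl -!actE cl_genD linearD add_lfunE linearD.
Qed.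

Lemma act_sq Z : act Z *m act Z = (- pseudo_dot Z Z)%:M.
Proof.
apply: mx_eqP => x; rewrite -[x]vecK -mulmxA -!actE mul_scalar_mx -linearZ; congr (coo _).
by rewrite -comp_lfunE -repr_mapM cl_gen_sq linearZ scale_lfunE repr_map1 id_lfunE.
Qed.

Lemma act_adj Z : (act Z)^T *m gram = - (gram *m act Z).
Proof.
apply/matrixP => i j.
have := @adm_skew _ _ _ X Z (vec (delta_mx i 0)) (vec (delta_mx j 0)).
rewrite !gramE !actE !vecK trmx_mul trmx_delta -!mulmxA !mulmxA.
by rewrite -[_ *m (act Z)^T *m gram]mulmxA -[_ *m gram *m act Z]mulmxA !delta_entry => ->;
  rewrite [RHS]mxE.
Qed.

(** The canonical basis, with indices in nat: r + 0 and 0 + r are then treated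
    alike. *)
Definition unit_row i : 'rV[R]_(r + s) := \row_k (k == i :> nat)%:R.

Lemma unit_rowE (k : 'I_(r + s)) : unit_row k = delta_mx 0 k.
Proof. by apply/rowP => l; rewrite !mxE eqxx. Qed.

Definition act_gens i := act (unit_row i).

Lemma act_gens_system : clifford_system (r + s) c (fun=> -1) gram 1%:M act_gens.
Proof.
have m0 : (0 < m)%N by rewrite -dimvf (adm_neq0 X).
constructor.
- exact: gram_sym.
- exact: gram_unit.
- by move=> i lt; rewrite /act_gens act_sq (unit_rowE (Ordinal lt)) hc mulrN1.
- move=> i j lti ltj ij.
  have := act_sq (unit_row i + unit_row j).
  have -> : pseudo_dot (unit_row i + unit_row j) (unit_row i + unit_row j) =
      pseudo_dot (unit_row i) (unit_row i) + pseudo_dot (unit_row j) (unit_row j).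
    rewrite !pseudo_dotE -big_split; apply: eq_bigr => k _; rewrite !mxE hc.
    have [->|_] /= := eqVneq (k : nat) i; last by rewrite mulr0n !add0r !mul0r add0r.
    by rewrite (negPf ij) mulr0n !addr0 !mul0r addr0.
  rewrite actD mulmxDl !mulmxDr !act_sq.
  have -> (x y : R) : (- (x + y))%:M = (- x)%:M + (- y)%:M :> 'M[R]_m by rewrite opprD raddfD.
  set p := (- pseudo_dot (unit_row i) _)%:M; set q := (- pseudo_dot (unit_row j) _)%:M => h.
  apply/eqP; rewrite -addr_eq0; apply/eqP/(@addrI _ p)/(@addIr _ q).
  by rewrite addr0 -h !addrA.
- by move=> i lt; rewrite act_adj scaleN1r.
- by rewrite mulmx1.
- by rewrite trmx1 mul1mx mulmx1.
- by move=> i lt; rewrite mul1mx mulmx1.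
- apply/eqP => /matrixP /(_ (Ordinal m0) (Ordinal m0)).
  by rewrite !mxE eqxx => /eqP; rewrite oner_eq0.
Qed.
End FromAdmissible.

(** * Integral bases from embedded models *)

Section Generic.
Variable R : realType.

Lemma orthogonal_free (U : vectType R) (h : U -> U -> R) n (X : n.-tuple U) :
  (forall a x y z, h (a *: x + y) z = a * h x z + h y z) ->
  (forall i j, i != j -> h (tnth X i) (tnth X j) = 0) ->
  (forall i, h (tnth X i) (tnth X i) != 0) -> free X.
Proof.
move=> hl ho hn; apply/freeP => k sum0 j.
have h0 z : h 0 z = 0.
  by have := hl 1 0 0 z; rewrite scale1r addr0 mul1r => /eqP; rewrite -subr_eq subrr eq_sym => /eqP.
have hs z (F : 'I_n -> U) : h (\sum_i F i) z = \sum_i h (F i) z.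
  apply: (big_morph (fun x => h x z)) => [x y|]; last exact: h0.
  by rewrite -{1}[x]scale1r hl mul1r.
have := hs (tnth X j) (fun i => k i *: X`_i); rewrite sum0 h0 (bigD1 j) //= big1 => [|i ij].
  rewrite addr0 -[k j *: _]addr0 hl h0 addr0 -tnth_nth => /esym/eqP.
  by rewrite mulf_eq0 (negPf (hn j)) orbF => /eqP.
by rewrite -[k i *: _]addr0 hl h0 addr0 -tnth_nth ho // mulr0.
Qed.

Lemma eq_on_basis (U V : vectType R) n (X : n.-tuple U) (F G : {linear U -> V}) :
  basis_of fullv X -> (forall i, F (tnth X i) = G (tnth X i)) -> F =1 G.
Proof.
move=> bX FG u; rewrite (coord_basis bX (memvf u)) !linear_sum; apply: eq_bigr => i _.
by rewrite !linearZ -tnth_nth FG.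
Qed.

Lemma basis_iso (U V : vectType R) n (X : n.-tuple U) (Y : n.-tuple V) :
  basis_of fullv X -> basis_of fullv Y ->
  exists F : {linear U -> V}, bijective F /\ forall i, F (tnth X i) = tnth Y i.
Proof.
move=> bX bY.
have [F hF] := linear_of_free X Y; have [G hG] := linear_of_free Y X.
have FX i : F (tnth X i) = tnth Y i.
  by rewrite !(tnth_nth 0) -hF ?size_tuple ?(basis_free bX) // (nth_map 0) ?size_tuple.
have GY i : G (tnth Y i) = tnth X i.
  by rewrite !(tnth_nth 0) -hG ?size_tuple ?(basis_free bY) // (nth_map 0) ?size_tuple.
exists F; split=> //; exists G.
  by apply: (@eq_on_basis _ _ _ X (G \o F) idfun) => // i /=; rewrite FX GY.
by apply: (@eq_on_basis _ _ _ Y (F \o G) idfun) => // i /=; rewrite GY FX.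
Qed.

(** Were two of the A k nonzero at the same place, their product would have a
    nonzero diagonal entry; but this product is skew. *)
Lemma skew_system_disjoint n d (A : nat -> 'M[R]_d) :
  (forall i j, (i < n)%N -> (j < n)%N -> i != j -> A i *m A j = - (A j *m A i)) ->
  (forall i, (i < n)%N -> (A i)^T = - A i) -> (forall i, (i < n)%N -> signed_perm (A i)) ->
  forall k l x y, (k < n)%N -> (l < n)%N -> A k x y != 0 -> A l x y != 0 -> k = l.
Proof.
move=> anti skew perm k l x y ltk ltl Ak Al; apply/eqP/negP => /negP kl.
have diag0 : (A k *m A l) x x = 0.
  have : (A k *m A l)^T = - (A k *m A l).
    by rewrite trmx_mul !skew // mulNmx mulmxN opprK; apply: anti; rewrite // eq_sym.
  move/matrixP/(_ x x); rewrite [LHS]mxE [RHS]mxE => /eqP.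
  by rewrite -addr_eq0 -mulr2n mulrn_eq0 /= => /eqP.
have Alyx : A l y x = - A l x y by rewrite -[A l in LHS]trmxK mxE skew // mxE.
have [i [b h]] := signed_perm_entry x (perm l ltl).
have yi : y = i.
  apply/eqP/negPn/negP => yi; have : A l y x != 0 by rewrite Alyx oppr_eq0.
  by rewrite h (negPf yi) mulr0 eqxx.
move: diag0; rewrite mxE (bigD1 y) //= big1 => [|z zy].
  rewrite addr0 Alyx => /eqP; rewrite mulf_eq0 oppr_eq0 => /orP[] h'.
    by rewrite h' in Ak.
  by rewrite h' in Al.
by rewrite h -yi (negPf zy) !mulr0.
Qed.
End Generic.

Lemma pseudo_dot_linearl (R : realType) r s (a : R) (x y z : 'rV[R]_(r + s)) :
  pseudo_dot (a *: x + y) z = a * pseudo_dot x z + pseudo_dot y z.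
Proof.
rewrite !pseudo_dotE mulr_sumr -big_split; apply: eq_bigr => i _.
by rewrite /= mxE [(a *: x) 0 i]mxE mulrDl -mulrA.
Qed.

Section ModelBasis.
Variables (R : realType) (r s : nat) (c e : R) (X : admissible R r s) (d : nat).
Variables (A : nat -> 'M[R]_d) (H : 'M[R]_d) (phi : 'M[R]_(dim X, d)).
Local Notation n := (r + s)%N.
Hypothesis hc : forall k : 'I_n,
  pseudo_dot (delta_mx 0 k) (delta_mx 0 k : 'rV[R]_n) = c.
Hypothesis c1 : c = 1 \/ c = -1.
Hypothesis e1 : e = 1 \/ e = -1.
Hypothesis dimd : (dim X <= d)%N.
Hypothesis anti : forall i j,
  (i < n)%N -> (j < n)%N -> i != j -> A i *m A j = - (A j *m A i).
Hypothesis skew : forall i, (i < n)%N -> (A i)^T = - A i.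
Hypothesis perm : forall i, (i < n)%N -> signed_perm (A i).
Hypothesis Hdiag : signed_diag H.
Hypothesis HH : H *m H = 1%:M.
Hypothesis phiA : forall i, (i < n)%N -> act_gens X i *m phi = phi *m (H *m A i).
Hypothesis phiG : phi^T *m gram X *m phi = e *: H.

(** With this sign of the central vectors the structure constants are the
    entries of the A k, whatever c and e; see [model_structure]. *)
Definition model_sign := - (c * e).
Definition model_vec (a : 'I_d) : htype X := (vec (col a phi), 0).
Definition model_cen (k : 'I_n) : htype X := (0, model_sign *: unit_row R r s k).

Lemma model_sign2 : model_sign * model_sign = 1.
Proof. by rewrite /model_sign mulrNN mulrACA (sqr_sign c1) (sqr_sign e1) mulr1. Qed.

Lemma model_sign_neq0 : model_sign != 0.
Proof. by apply/eqP => t0; have := model_sign2; rewrite t0 mul0r => /eqP;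
  rewrite eq_sym oner_eq0. Qed.

Lemma form_entry x y (Y : 'M[R]_(dim X)) :
  ((col x phi)^T *m Y *m col y phi) 0 0 = (phi^T *m Y *m phi) x y.
Proof. by rewrite !colE trmx_mul trmx_delta -[RHS]delta_entry !mulmxA. Qed.

Lemma model_form x y : adm_form X (model_vec x).1 (model_vec y).1 = e * H x y.
Proof. by rewrite gramE !vecK form_entry phiG mxE. Qed.

Lemma dot_unit (k l : 'I_n) :
  pseudo_dot (unit_row R r s k) (unit_row R r s l) = if k == l then c else 0.
Proof.
rewrite !unit_rowE pseudo_dot_delta hc mxE eqxx /= eq_sym.
by case: eqP; rewrite ?mulr1 ?mulr0.
Qed.

Lemma model_vbracket x y k : vbracket (model_vec x).1 (model_vec y).1 0 k = model_sign * A k x y.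
Proof.
rewrite mxE hc gramE actE !vecK trmx_mul -[_ *m (act _ _)^T *m _]mulmxA form_entry.
rewrite act_adj -unit_rowE -/(act_gens X k) mulmxN mulNmx mulmxA -[_ *m _ *m phi]mulmxA.
rewrite phiA ?ltn_ord // mulmxA phiG -scalemxAl mulmxA HH mul1mx [in LHS]mxE [in LHS]mxE.
by rewrite mulrN mulrA mulNr.
Qed.

Lemma model_hbracket x y :
  hbracket (model_vec x) (model_vec y) = \sum_(k < n) A k x y *: model_cen k.
Proof.
rewrite [RHS]surjective_pairing; congr pair.
  by rewrite (big_morph fst (id1 := 0) (op1 := +%R)) //= big1 // => k _; rewrite scaler0.
rewrite (big_morph snd (id1 := 0) (op1 := +%R)) //=; apply/rowP => l.
rewrite model_vbracket summxE (bigD1 l) //= big1 ?addr0 => [|k kl].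
  by rewrite !mxE eqxx mulr1 mulrC.
by rewrite !mxE eq_sym (inj_eq val_inj) (negPf kl) !mulr0.
Qed.

Lemma model_hbracket1 x y (k : 'I_n) : A k x y != 0 ->
  hbracket (model_vec x) (model_vec y) = A k x y *: model_cen k.
Proof.
move=> Ak; rewrite model_hbracket (bigD1 k) //= big1 ?addr0 // => l lk.
have [->|Al] := eqVneq (A l x y) 0; first by rewrite scale0r.
case/eqP: lk; apply: val_inj.
exact: (skew_system_disjoint anti skew perm (ltn_ord l) (ltn_ord k) Al Ak).
Qed.

Lemma model_entry x y k : (k < n)%N -> A k x y != 0 -> A k x y = 1 \/ A k x y = -1.
Proof.
move=> ltk; have [i [b h]] := signed_perm_entry y (perm ltk); rewrite h.
case: (x == i); last by rewrite mulr0 eqxx.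
by rewrite mulr1; clear h; case: b => _; [right|left].
Qed.

Lemma model_hform_vec x y : hform (model_vec x) (model_vec y) = e * H x y.
Proof.
rewrite /hform model_form /= /pseudo_dot !big1 ?subr0 ?addr0 // => i _; by rewrite mxE mul0r.
Qed.

Lemma model_hform_cen k l : hform (model_cen k) (model_cen l) = if k == l then c else 0.
Proof.
rewrite /hform /= linear0l add0r -dot_unit !pseudo_dotE; apply: eq_bigr => i _.
by rewrite !mxE hc [c * (model_sign * _)]mulrCA mulrACA model_sign2 mul1r.
Qed.

Lemma model_hform_mix x k : hform (model_vec x) (model_cen k) = 0.
Proof.
rewrite /hform /= linear0r add0r /pseudo_dot !big1 ?subr0 // => i _; by rewrite mxE mul0r.
Qed.

Lemma signed_diag_value x y : H x y = 0 \/ x = y /\ (H x y = 1 \/ H x y = -1).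
Proof.
have [b h] := Hdiag y; move/colP: h => /(_ x); rewrite !mxE eqxx andbT => ->.
case: eqP => [->|_]; last by left; rewrite mulr0.
by right; split=> //; rewrite mulr1; case: b; [right|left].
Qed.

Lemma hform_linearl (a : R) (x y z : htype X) : hform (a *: x + y) z = a * hform x z + hform y z.
Proof.
rewrite /hform /= linearPl /= pseudo_dot_linearl.
by move: (pseudo_dot x.2 z.2) (pseudo_dot y.2 z.2) => p q; rewrite mulrDr addrACA.
Qed.

Lemma hformC (x y : htype X) : hform x y = hform y x.
Proof. by rewrite /hform pseudo_dotC (hermitian_subproof _ x.1) /= expr0 mul1r. Qed.

Section Tuples.
Variables (p : nat) (hp : n = p).
Definition model_vecs := [tuple model_vec a | a < d].
Definition model_cens := [tuple model_cen (cast_ord (esym hp) k) | k < p].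

Lemma model_vecsE a : tnth model_vecs a = model_vec a.
Proof. exact: tnth_mktuple. Qed.
Lemma model_censE k : tnth model_cens k = model_cen (cast_ord (esym hp) k).
Proof. exact: tnth_mktuple. Qed.

Lemma model_structure x y :
  hbracket (tnth model_vecs x) (tnth model_vecs y) = \sum_(k < p) A k x y *: tnth model_cens k.
Proof.
rewrite !model_vecsE model_hbracket; under [RHS]eq_bigr do rewrite model_censE.
by case: p / hp; apply: eq_bigr => k _; rewrite cast_ord_id.
Qed.

Lemma model_hform_v i j : i != j -> hform (tnth model_vecs i) (tnth model_vecs j) = 0.
Proof.
move=> ij; rewrite !model_vecsE model_hform_vec.
case: (signed_diag_value i j) => [->|[ij' _]]; first by rewrite mulr0.
by rewrite ij' eqxx in ij.
Qed.

Lemma model_hform_vv i : hform (tnth model_vecs i) (tnth model_vecs i) = 1 \/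
  hform (tnth model_vecs i) (tnth model_vecs i) = -1.
Proof.
rewrite !model_vecsE model_hform_vec; case: (signed_diag_value i i) => [Hi|[_ h]]; last first.
  by case: e1 h => -> [] ->; rewrite ?mulrNN ?mul1r ?mulr1; [left|right|right|left].
have [b h] := Hdiag i; move/colP: h => /(_ i); rewrite !mxE Hi !eqxx mulr1 => /eqP.
by rewrite eq_sym signr_eq0.
Qed.

Lemma model_hform_Z i j :
  hform (tnth model_cens i) (tnth model_cens j) = if i == j then c else 0.
Proof. by rewrite !model_censE model_hform_cen (inj_eq (@cast_ord_inj _ _ _)). Qed.

Lemma model_hform_vZ i j : hform (tnth model_vecs i) (tnth model_cens j) = 0.
Proof. by rewrite model_vecsE model_censE model_hform_mix. Qed.

Lemma model_free : free (model_vecs ++ model_cens).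
Proof.
have c0 : c != 0 by case: c1 => ->; rewrite ?oppr_eq0 oner_eq0.
apply: (@orthogonal_free R (htype X) (@hform R r s X) _
  [tuple of model_vecs ++ model_cens] hform_linearl).
  move=> i j; case: (split_ordP i) => k ->; case: (split_ordP j) => l ->;
    rewrite ?tnth_lshift ?tnth_rshift.
  - by rewrite eq_lshift => kl; apply: model_hform_v.
  - by rewrite model_hform_vZ.
  - by rewrite hformC model_hform_vZ.
  - by rewrite eq_rshift => /negPf kl; rewrite model_hform_Z kl.
move=> i; case: (split_ordP i) => k ->; rewrite ?tnth_lshift ?tnth_rshift.
  by case: (model_hform_vv k) => ->; rewrite ?oppr_eq0 oner_eq0.
by rewrite model_hform_Z eqxx.
Qed.

(** Orthogonality makes the family free, and the bound on the dimension of X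
    makes it a basis. *)
Lemma model_integral_basis : integral_basis model_vecs model_cens.
Proof.
constructor.
- rewrite basisEfree model_free subvf /= size_cat !size_tuple dimvf.
  have -> : dim (htype X) = (dim X + dim 'rV[R]_n)%N by [].
  have -> : dim 'rV[R]_n = p by rewrite -hp dim_matrix; apply: mul1n.
  by rewrite !card_ord leq_add2r.
- by move=> a; rewrite model_vecsE.
- by move=> a; rewrite model_censE.
- move=> x y; rewrite !mem_cat => /orP[] /tnthP[i ->] /orP[] /tnthP[j ->] xy.
  + by apply: model_hform_v; apply: contraNneq xy => ->.
  + exact: model_hform_vZ.
  + by rewrite hformC; apply: model_hform_vZ.
  + by rewrite model_hform_Z; case: (eqVneq i j) xy => [->|//]; rewrite eqxx.
- move=> x; rewrite mem_cat => /orP[] /tnthP[i ->]; first exact: model_hform_vv.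
  by rewrite model_hform_Z eqxx.
- move=> x y; rewrite !model_vecsE.
  have [k Ak|none] := pickP (fun k : 'I_n => A k x y != 0).
    right; exists (cast_ord hp k); rewrite model_censE cast_ordK (model_hbracket1 Ak).
    by case: (model_entry (ltn_ord k) Ak) => ->; rewrite ?scale1r ?scaleN1r; [left|right].
  left; rewrite model_hbracket big1 // => k _; have /negbFE/eqP -> := none k.
  by rewrite scale0r.
- move=> k' x; rewrite model_censE; set k := cast_ord _ k'.
  have [i [b h]] := signed_perm_entry x (perm (ltn_ord k)).
  have Axy y : A k x y = - A k y x by rewrite -[A k in LHS]trmxK mxE skew ?ltn_ord // mxE.
  exists i; split.
    have Ak : A k x i != 0 by rewrite Axy h eqxx mulr1 oppr_eq0 signr_eq0.
    rewrite !model_vecsE (model_hbracket1 Ak).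
    by case: (model_entry (ltn_ord k) Ak) => ->; rewrite ?scale1r ?scaleN1r; [left|right].
  move=> y; rewrite !model_vecsE => hy; apply/esym/eqP/negPn/negP => yi.
  have Ak0 : A k x y = 0 by rewrite Axy h (negPf yi) mulr0 oppr0.
  have := model_vbracket x y k; rewrite Ak0 mulr0.
  have -> : vbracket (model_vec x).1 (model_vec y).1 = (hbracket (model_vec x) (model_vec y)).2
    by [].
  suff t0 : (hbracket (model_vec x) (model_vec y)).2 0 k != 0 by move/eqP; rewrite (negPf t0).
  case: hy => -> /=; [|rewrite mxE oppr_eq0]; rewrite !mxE eqxx mulr1; exact: model_sign_neq0.
Qed.
End Tuples.
End ModelBasis.

(** * Isomorphisms from equal structure constants *)

Section Iso.
Variable R : realType.

Lemma linear_eq_on_basis (U V : vectType R) n (X : n.-tuple U) (F G : U -> V) :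
  linear F -> linear G -> basis_of fullv X -> (forall i, F (tnth X i) = G (tnth X i)) -> F =1 G.
Proof.
move=> lF lG bX.
pose F' : {linear U -> V} := HB.pack F (GRing.isLinear.Build R U V _ F lF).
pose G' : {linear U -> V} := HB.pack G (GRing.isLinear.Build R U V _ G lG).
exact: (@eq_on_basis R U V n X F' G' bX).
Qed.

Lemma hbracketC r s (X : admissible R r s) (x y : htype X) : hbracket y x = - hbracket x y.
Proof. by rewrite /hbracket vbracketN; congr pair; rewrite /= oppr0. Qed.

Lemma hbracket_linearr r s (X : admissible R r s) (a : R) (x y z : htype X) :
  hbracket z (a *: x + y) = a *: hbracket z x + hbracket z y.
Proof. by rewrite hbracketC hbracket_linearl opprD -scalerN -!hbracketC. Qed.

Lemma hbracket_center r s (X : admissible R r s) (x y : htype X) : x.1 = 0 -> hbracket x y = 0.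
Proof. by move=> x0; rewrite /hbracket x0 vbracket0l. Qed.

Lemma iso_of_structure r s r' s' (M : admissible R r s) (N : admissible R r' s') m n
    (v : m.-tuple (htype M)) (Z : n.-tuple (htype M))
    (v' : m.-tuple (htype N)) (Z' : n.-tuple (htype N)) (A : nat -> 'M[R]_m) :
  integral_basis v Z -> integral_basis v' Z' ->
  (forall x y, hbracket (tnth v x) (tnth v y) = \sum_(k < n) A k x y *: tnth Z k) ->
  (forall x y, hbracket (tnth v' x) (tnth v' y) = \sum_(k < n) A k x y *: tnth Z' k) ->
  integral_isomorphic M N.
Proof.
move=> ib ib' st st'.
have bX : basis_of fullv [tuple of v ++ Z] := ib_basis ib.
have [f [fbij fX]] := basis_iso bX (ib_basis ib' : basis_of fullv [tuple of v' ++ Z']).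
have fv i : f (tnth v i) = tnth v' i by have := fX (lshift n i); rewrite !tnth_lshift.
have fZ k : f (tnth Z k) = tnth Z' k by have := fX (rshift m k); rewrite !tnth_rshift.
exists m, n, v, Z, v', Z', f; split=> //; split=> // x y.
have on_basis i j : f (hbracket (tnth [tuple of v ++ Z] i) (tnth [tuple of v ++ Z] j)) =
    hbracket (f (tnth [tuple of v ++ Z] i)) (f (tnth [tuple of v ++ Z] j)).
  have zl k u : f (hbracket (tnth Z k) u) = 0.
    by rewrite hbracket_center ?linear0 //; apply: ib_Z ib k.
  have zl' k u : hbracket (tnth Z' k) u = 0 by apply/hbracket_center/(ib_Z ib').
  case: (split_ordP i) => k ->; case: (split_ordP j) => l ->;
    rewrite ?tnth_lshift ?tnth_rshift ?fv ?fZ.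
  - by rewrite st st' linear_sum; apply: eq_bigr => q _; rewrite linearZ fZ.
  - by rewrite hbracketC linearN zl oppr0 hbracketC zl' oppr0.
  - by rewrite zl zl'.
  - by rewrite zl zl'.
have step j u : f (hbracket u (tnth [tuple of v ++ Z] j)) =
    hbracket (f u) (f (tnth [tuple of v ++ Z] j)).
  move: u; apply: (linear_eq_on_basis _ _ bX) => // a w z.
    by rewrite hbracket_linearl linearP.
  by rewrite linearP hbracket_linearl.
move: y; apply: (linear_eq_on_basis _ _ bX) => [a w z|a w z|j]; last exact: step.
  by rewrite hbracket_linearr linearP.
by rewrite linearP hbracket_linearr.
Qed.
End Iso.

(** * The minimal dimensions, and the isomorphism when a model exists *)

Section IfDirection.
Variables (R : realType).

Lemma sign_pos r (k : 'I_(r + 0)) :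
  pseudo_dot (delta_mx 0 k) (delta_mx 0 k : 'rV[R]_(r + 0)) = 1.
Proof.
by case: (split_ordP k) => [i|[]//] ->; rewrite pseudo_dot_lshift mxE !eqxx.
Qed.

Lemma sign_neg r (k : 'I_(0 + r)) :
  pseudo_dot (delta_mx 0 k) (delta_mx 0 k : 'rV[R]_(0 + r)) = -1.
Proof.
by case: (split_ordP k) => [[]//|i] ->; rewrite pseudo_dot_rshift mxE !eqxx.
Qed.

Lemma minimal_dim_pos r n N d A eta (M : admissible R r 0) : minimal_admissible M ->
  @model R n N d (fun=> -1) A eta -> (r <= N)%N -> (dim M <= d)%N.
Proof.
move=> hM mo rN.
have lt i : (i < r + 0)%N -> (i < N)%N by rewrite addn0 => /leq_trans; apply.
have [||||||X <-] := @exists_admissible R r 0 d 1 A 1%:M (@sign_pos r).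
- exact: trmx1.
- exact: unitmx1.
- exact: mo_gt0 mo.
- by move=> i /lt h; rewrite (mo_sq mo).
- by move=> i j /lt hi /lt hj; apply: mo_anti mo _ _ hi hj.
- by move=> i /lt h; rewrite mulmx1 mul1mx (mo_sym mo) // scaleN1r.
by rewrite -dimvf; apply: hM.
Qed.

(** The matrices eta A_k, with the form eta, are an admissible module of
    Cl_{0,r}. *)
Lemma minimal_dim_neg r N d A eta (M : admissible R 0 r) : minimal_admissible M ->
  @model R r N d (fun=> -1) A eta -> (dim M <= d)%N.
Proof.
move=> hM mo.
have lt i : (i < 0 + r)%N -> (i < N)%N by rewrite add0n => /leq_trans; apply; apply: mo_le mo.
have etaA i : (i < r)%N -> eta *m A i = - (A i *m eta) by apply: (mo_eta mo).
have pair i j : (i < r)%N -> (j < r)%N -> eta *m A i *m (eta *m A j) = - (A i *m A j).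
  by move=> hi hj; rewrite etaA // mulNmx mulmxA -[A i *m eta *m eta]mulmxA (mo_eta2 mo) mulmx1.
have [||||||X <-] := @exists_admissible R 0 r d (-1) (fun i => eta *m A i) eta (@sign_neg r).
- exact: mo_etaT mo.
- by case: (mulmx1_unit (mo_eta2 mo)).
- exact: mo_gt0 mo.
- by move=> i h; rewrite pair // (mo_sq mo) ?lt // -raddfN.
- by move=> i j hi hj ij; rewrite !pair // [A i *m _](mo_anti mo) ?lt.
- move=> i h; rewrite trmx_mul (mo_etaT mo) -mulmxA (mo_eta2 mo) mulmx1 mulmxA (mo_eta2 mo) mul1mx.
  by rewrite (mo_sym mo) ?lt // scaleN1r.
by rewrite -dimvf; apply: hM.
Qed.

(** Minimality bounds the dimensions of M and X by that of the model, which both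
    contain by universality; the two images of the canonical basis have the same
    structure constants. *)
Lemma model_integral_isomorphic r N d A eta (M : admissible R r 0) (X : admissible R 0 r) :
  minimal_admissible M -> minimal_admissible X ->
  @model R r N d (fun=> -1) A eta -> integral_isomorphic M X.
Proof.
move=> hM hX mo.
have lt i : (i < r)%N -> (i < N)%N by move/leq_trans; apply; apply: mo_le mo.
have dM : (dim M <= d)%N := minimal_dim_pos hM mo (mo_le mo).
have dX : (dim X <= d)%N := minimal_dim_neg hX mo.
have anti i j : (i < r)%N -> (j < r)%N -> i != j -> A i *m A j = - (A j *m A i).
  by move=> /lt hi /lt hj; apply: mo_anti mo _ _ hi hj.
have skew i : (i < r)%N -> (A i)^T = - A i.
  by move=> /lt h; rewrite (mo_sym mo) // scaleN1r.
have p1 : (1 : R) = 1 \/ (1 : R) = -1 by left.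
have m1 : (-1 : R) = 1 \/ (-1 : R) = -1 by right.
have twS c := twist_sq c (mo_eta2 mo).
have twD c := signed_diag_twist c (mo_diag mo).
have := @act_gens_system R r 0 1 M (@sign_pos r); rewrite addn0.
move/(mo_univ mo p1) => [e [phi [e1 _ phiA phiG]]].
have [e' [phi' [e1' _ phiA' phiG']]] := mo_univ mo m1 (@act_gens_system R 0 r (-1) X (@sign_neg r)).
have ltr : forall i, (i < r + 0)%N -> (i < r)%N by move=> i; rewrite addn0.
apply: (@iso_of_structure R r 0 0 r M X d r (model_vecs phi) (model_cens 1 e M (addn0 r))
  (model_vecs phi') (model_cens (-1) e' X (add0n r)) A).
- apply: (@model_integral_basis R r 0 1 e M d A (twist 1 eta) phi) => //.
  + exact: sign_pos.
  + by move=> i j /ltr hi /ltr hj; apply: anti.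
  + by move=> i /ltr; apply: skew.
  + by move=> i /ltr; apply: (mo_perm mo).
  + by move=> i /ltr; apply: phiA.
- apply: (@model_integral_basis R 0 r (-1) e' X d A (twist (-1) eta) phi') => //.
  + exact: sign_neg.
  + exact: (mo_perm mo).
- apply: (@model_structure R r 0 1 e M d A (twist 1 eta) phi (@sign_pos r) (twS 1) _ phiG).
  by move=> i /ltr; apply: phiA.
- exact: (@model_structure R 0 r (-1) e' X d A (twist (-1) eta) phi'
    (@sign_neg r) (twS (-1)) phiA' phiG').
Qed.
End IfDirection.

(** * The involution carried by an integral isomorphism *)

Lemma dot0l (R : realType) p q (x : 'rV[R]_(p + q)) : pseudo_dot 0 x = 0.
Proof. by rewrite /pseudo_dot !big1 ?subr0 // => i _; rewrite mxE mul0r. Qed.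

Lemma pseudo_dot_pos (R : realType) r (x : 'rV[R]_(r + 0)) : 0 <= pseudo_dot x x.
Proof.
rewrite /pseudo_dot [X in _ - X]big_ord0 subr0 sumr_ge0 // => i _.
by rewrite -expr2 sqr_ge0.
Qed.

Lemma pseudo_dot_neg (R : realType) r (x : 'rV[R]_(0 + r)) : pseudo_dot x x <= 0.
Proof.
rewrite /pseudo_dot [X in X - _]big_ord0 sub0r oppr_le0 sumr_ge0 // => i _.
by rewrite -expr2 sqr_ge0.
Qed.

Section IntegralBasisFacts.
Variables (R : realType) (r s : nat) (M : admissible R r s) (m n : nat).
Variables (v : m.-tuple (htype M)) (Z : n.-tuple (htype M)).
Hypothesis ib : integral_basis v Z.

Lemma ib_tnth_inj : injective (tnth [tuple of v ++ Z]).
Proof. by apply/tuple_uniqP; apply: free_uniq; apply: basis_free (ib_basis ib). Qed.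

Lemma ib_ortho_v i j : i != j -> hform (tnth v i) (tnth v j) = 0.
Proof.
move=> ij; apply: (ib_orthogonal ib); rewrite ?mem_cat ?mem_tnth //.
apply: contra ij => /eqP; rewrite -!(tnth_lshift v Z) => /ib_tnth_inj/eqP.
by rewrite eq_lshift.
Qed.

Lemma ib_ortho_Z i j : i != j -> hform (tnth Z i) (tnth Z j) = 0.
Proof.
move=> ij; apply: (ib_orthogonal ib); rewrite ?mem_cat ?mem_tnth ?orbT //.
apply: contra ij => /eqP; rewrite -!(tnth_rshift v Z) => /ib_tnth_inj/eqP.
by rewrite eq_rshift.
Qed.

Lemma ib_form_v i j : adm_form M (tnth v i).1 (tnth v j).1 = hform (tnth v i) (tnth v j).
Proof. by rewrite /hform !(ib_v ib) dot0l addr0. Qed.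

Lemma ib_form_Z i j : pseudo_dot (tnth Z i).2 (tnth Z j).2 = hform (tnth Z i) (tnth Z j).
Proof. by rewrite /hform !(ib_Z ib) linear0l add0r. Qed.

Lemma ib_norm_v i : hform (tnth v i) (tnth v i) = 1 \/ hform (tnth v i) (tnth v i) = -1.
Proof. by apply: (ib_norm ib); rewrite mem_cat mem_tnth. Qed.

Lemma ib_norm_Z i : hform (tnth Z i) (tnth Z i) = 1 \/ hform (tnth Z i) (tnth Z i) = -1.
Proof. by apply: (ib_norm ib); rewrite mem_cat mem_tnth orbT. Qed.

Lemma ib_on_basis (U : vectType R) (F G : htype M -> U) : linear F -> linear G ->
  (forall i, F (tnth v i) = G (tnth v i)) -> (forall k, F (tnth Z k) = G (tnth Z k)) -> F =1 G.
Proof.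
move=> lF lG hv hZ; apply: (linear_eq_on_basis lF lG (ib_basis ib : basis_of fullv [tuple of v
  ++ Z])).
by move=> i; case: (split_ordP i) => k ->; rewrite ?tnth_lshift ?tnth_rshift.
Qed.
End IntegralBasisFacts.

(** G and P are the Gram matrices of two forms, the columns of V an orthonormal
    basis of the first and, up to signs, of the second; then V diagonalises
    G^-1 P, with eigenvalues 1 and -1. *)
Lemma orthonormal_involution (R : fieldType) p q (G P : 'M[R]_p) (V : 'M[R]_(p, q)) :
  V^T *m G *m V = 1%:M -> V *m V^T *m G = 1%:M ->
  (V^T *m P *m V) *m (V^T *m P *m V) = 1%:M ->
  (invmx G *m P) *m (invmx G *m P) = 1%:M.
Proof.
move=> VGV VVG DD; have GVV := mulmx1C VVG.
have Gu : G \in unitmx by case: (mulmx1_unit VVG).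
have -> : invmx G = V *m V^T by rewrite -[RHS]mulmx1 -(mulmxV Gu) mulmxA VVG mul1mx.
rewrite -[P in X in _ *m X]mulmx1 -{1}VVG.
set D := V^T *m P *m V in DD.
have -> : V *m V^T *m P *m (V *m V^T *m (P *m (V *m V^T *m G))) = V *m (D *m D) *m V^T *m G.
  by rewrite /D !mulmxA.
by rewrite DD mulmx1.
Qed.

Lemma bilinear_zero (R : realType) (U : vectType R) n (X : n.-tuple U) (h : U -> U -> R) :
  basis_of fullv X -> (forall a x y z, h (a *: x + y) z = a * h x z + h y z) ->
  (forall x y, h x y = h y x) -> (forall i j, h (tnth X i) (tnth X j) = 0) -> forall x y, h x y = 0.
Proof.
move=> bX hl hC h0 x y.
have l z : linear (fun x => h x z : R^o) by move=> a u w; apply: hl.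
have l0 : linear (fun=> 0 : R^o) by move=> U' a u w; rewrite scaler0 addr0.
have step j u : h u (tnth X j) = 0.
  exact: (linear_eq_on_basis (l (tnth X j)) (l0 U) bX (fun i => h0 i j)).
rewrite hC; apply: (linear_eq_on_basis (l x) (l0 U) bX) => j.
by rewrite hC step.
Qed.

Section Components.
Variables (R : realType) (r s r' s' : nat) (M : admissible R r s) (N : admissible R r' s').
Variables (m n : nat) (v : m.-tuple (htype M)) (Z : n.-tuple (htype M)).
Variables (v' : m.-tuple (htype N)) (Z' : n.-tuple (htype N)) (f : {linear htype M -> htype N}).
Hypotheses (ib : integral_basis v Z) (ib' : integral_basis v' Z').
Hypotheses (fv : forall i, f (tnth v i) = tnth v' i) (fZ : forall k, f (tnth Z k) = tnth Z' k).

(** f respects the decomposition into vectors and centre. *)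
Lemma iso_fst u : f (u.1, 0) = ((f u).1, 0).
Proof.
move: u; apply: (ib_on_basis ib).
- move=> a x y; rewrite -linearP; congr (f _).
  by rewrite /=; congr pair; rewrite /= scaler0 addr0.
- by move=> a x y; rewrite linearP; congr pair; rewrite /= scaler0 addr0.
- move=> i; have -> : ((tnth v i).1, 0) = tnth v i by rewrite [RHS]surjective_pairing (ib_v ib).
  by rewrite fv [LHS]surjective_pairing (ib_v ib').
- by move=> k; rewrite fZ !(ib_Z ib) !(ib_Z ib') linear0.
Qed.
End Components.

Section Grading.
Variables (R : realType) (r : nat) (M : admissible R r 0) (N : admissible R 0 r).
Hypothesis pos : forall v : M, v != 0 -> 0 < adm_form M v v.
Variables (m n : nat) (v : m.-tuple (htype M)) (Z : n.-tuple (htype M)).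
Variables (v' : m.-tuple (htype N)) (Z' : n.-tuple (htype N)) (f : {linear htype M -> htype N}).
Hypotheses (ib : integral_basis v Z) (ib' : integral_basis v' Z').
Hypotheses (fv : forall i, f (tnth v i) = tnth v' i) (fZ : forall k, f (tnth Z k) = tnth Z' k).
Hypothesis fbr : forall x y, f (hbracket x y) = hbracket (f x) (f y).

Let bX : basis_of fullv [tuple of v ++ Z] := ib_basis ib.

(** The Z_k have square norm 1 and their images square norm -1, the two centres
    being definite of opposite signs. *)
Lemma iso_center_form (u w : htype M) :
  pseudo_dot (f u).2 (f w).2 + pseudo_dot u.2 w.2 = 0.
Proof.
move: u w; apply: (bilinear_zero bX).
- move=> a x y z; rewrite [f _]linearP !pseudo_dot_linearl.
  by do 4!move: (pseudo_dot _ _) => ?; rewrite mulrDr addrACA.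
- by move=> x y; rewrite !(pseudo_dotC x.2) (pseudo_dotC (f x).2).
- move=> i j; case: (split_ordP i) => p ->; case: (split_ordP j) => q ->;
    rewrite ?tnth_lshift ?tnth_rshift ?fv ?fZ.
  + by rewrite !(ib_v ib) !(ib_v ib') !dot0l addr0.
  + by rewrite !(ib_v ib) !(ib_v ib') !dot0l addr0.
  + by rewrite !(ib_v ib) !(ib_v ib') pseudo_dotC [X in _ + X]pseudo_dotC !dot0l addr0.
  rewrite (ib_form_Z ib) (ib_form_Z ib').
  have [->|pq] := eqVneq p q; last by rewrite (ib_ortho_Z ib pq) (ib_ortho_Z ib' pq) addr0.
  have := ib_norm_Z ib' q; case=> h'.
    by have := pseudo_dot_neg (tnth Z' q).2; rewrite (ib_form_Z ib') h' ler10.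
  have := ib_norm_Z ib q; case=> h; first by rewrite h h' addNr.
  by have := pseudo_dot_pos (tnth Z q).2; rewrite (ib_form_Z ib) h oppr_ge0 ler10.
Qed.

Let V := \matrix_(i, j) coo (tnth v j).1 i 0.

Let frame_entry (Y : 'M[R]_(dim M)) i j :
  (V^T *m Y *m V) i j = ((coo (tnth v i).1)^T *m Y *m coo (tnth v j).1) 0 0.
Proof.
have colV l : col l V = coo (tnth v l).1 by apply/colP => q; rewrite !mxE.
by rewrite -!colV !colE trmx_mul trmx_delta -[LHS]delta_entry !mulmxA.
Qed.

Lemma frame_orthonormal : V^T *m gram M *m V = 1%:M.
Proof.
apply/matrixP => i j; rewrite frame_entry -gramE (ib_form_v ib) mxE.
have [->|ij] := eqVneq i j; last by rewrite (ib_ortho_v ib ij).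
have := ib_norm_v ib j; case=> // h; exfalso.
have v0 : (tnth v j).1 != 0.
  apply/eqP => v0; move: h; rewrite -(ib_form_v ib) v0 linear0l => /eqP.
  by rewrite eq_sym oppr_eq0 oner_eq0.
by have := pos v0; rewrite (ib_form_v ib) h oppr_gt0 ltr10.
Qed.

Lemma frame_complete : V *m V^T *m gram M = 1%:M.
Proof.
suff h (u : htype M) : V *m V^T *m gram M *m coo u.1 = coo u.1.
  by apply: mx_eqP => x; rewrite mul1mx -[x]vecK; apply: (h (vec x, 0)).
have colV l : col l V = coo (tnth v l).1 by apply/colP => q; rewrite !mxE.
move: u; apply: (ib_on_basis ib).
- by move=> a x y; rewrite /= linearP mulmxDr scalemxAr.
- by move=> a x y; rewrite /= linearP.
- move=> i; rewrite -colV -[V *m V^T *m _]mulmxA colE -!mulmxA [V^T *m _]mulmxA.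
  by rewrite [V^T *m _ *m _]mulmxA frame_orthonormal mul1mx.
- by move=> k; rewrite (ib_Z ib) linear0 mulmx0.
Qed.

(** The matrix eta is that of the form of N, pulled back to M, with respect to the
    form of M; in the basis v it is diagonal with entries 1 and -1.  Pulled back
    in the same way, the operator of N attached to f e_k is - eta J_k, because
    the brackets agree and f reverses the sign of the form on the centre.  Its
    square is 1 while that of J_k is -1. *)
Lemma iso_grading : exists eta : 'M[R]_(dim M),
  [/\ eta *m eta = 1%:M, eta^T *m gram M = gram M *m eta &
   forall i, (i < r)%N -> eta *m act_gens M i = - (act_gens M i *m eta)].
Proof.
have bX' : basis_of fullv [tuple of v' ++ Z'] := ib_basis ib'.
have [g [_ gX]] := basis_iso bX' bX.
have gv i : g (tnth v' i) = tnth v i by have := gX (lshift n i); rewrite !tnth_lshift.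
have gZ k : g (tnth Z' k) = tnth Z k by have := gX (rshift m k); rewrite !tnth_rshift.
have gf u : g (f u) = u.
  move: u; apply: (ib_on_basis ib) => [a x y|a x y|i|k]; rewrite ?linearP //.
    by rewrite fv gv.
  by rewrite fZ gZ.
have fg u : f (g u) = u.
  move: u; apply: (ib_on_basis ib') => [a x y|a x y|i|k]; rewrite ?linearP //.
    by rewrite gv fv.
  by rewrite gZ fZ.
have f1 := iso_fst ib ib' fv fZ.
have g1 := iso_fst ib' ib gv gZ.
pose F x := (f (x, 0)).1; pose F' y := (g (y, 0)).1.
have Fl : linear F.
  move=> a x y; rewrite /F.
  have -> : (a *: x + y, 0) = a *: (x, 0) + (y, 0) :> htype M.
    by congr pair; rewrite /= scaler0 addr0.
  by rewrite linearP.
have F'l : linear F'.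
  move=> a x y; rewrite /F'.
  have -> : (a *: x + y, 0) = a *: (x, 0) + (y, 0) :> htype N.
    by congr pair; rewrite /= scaler0 addr0.
  by rewrite linearP.
have Fu u : F u.1 = (f u).1 by rewrite /F f1.
have FF' y : F (F' y) = y by rewrite /F' Fu fg.
have F'F x : F' (F x) = x by rewrite /F' /F g1 gf.
pose FL : {linear M -> N} := HB.pack F (GRing.isLinear.Build R M N _ F Fl).
pose FL' : {linear N -> M} := HB.pack F' (GRing.isLinear.Build R N M _ F' F'l).
pose Fm := map_matrix F; pose Fm' := map_matrix F'.
have FmE x : coo (F x) = Fm *m coo x := map_matrixE FL x.
have FmE' x : coo (F' x) = Fm' *m coo x := map_matrixE FL' x.
have FmFm' : Fm *m Fm' = 1%:M.
  by apply: mx_eqP => x; rewrite -[x]vecK -mulmxA -FmE' -FmE FF' mul1mx.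
have Fm'Fm : Fm' *m Fm = 1%:M.
  by apply: mx_eqP => x; rewrite -[x]vecK -mulmxA -FmE -FmE' F'F mul1mx.
pose G := gram M; pose P := Fm^T *m gram N *m Fm.
have GT : G^T = G := gram_sym M; have Gu : G \in unitmx := gram_unit M.
have PT : P^T = P by rewrite /P !trmx_mul trmxK gram_sym mulmxA.
pose eta := invmx G *m P.
have Geta : G *m eta = P by rewrite /eta mulmxA mulmxV ?mul1mx.
pose D := V^T *m P *m V.
have DD : D *m D = 1%:M.
  have De i j : D i j = hform (tnth v' i) (tnth v' j).
    rewrite /D frame_entry /P -(ib_form_v ib') -!fv -!Fu gramE !FmE trmx_mul.
    by rewrite !mulmxA.
  apply/matrixP => i j; rewrite mxE (bigD1 i) //= big1 => [|k ki]; last first.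
    by rewrite De (ib_ortho_v ib') ?mul0r // eq_sym.
  rewrite addr0 !De [RHS]mxE; have [<-|ij] := eqVneq i j.
    by case: (ib_norm_v ib' i) => ->; rewrite ?mulrNN mulr1.
  by rewrite (ib_ortho_v ib' ij) mulr0.
have eta2 : eta *m eta = 1%:M.
  exact: orthonormal_involution frame_orthonormal frame_complete DD.
have etaG : eta^T *m G = G *m eta.
  by rewrite Geta /eta trmx_mul PT trmx_inv GT -mulmxA mulVmx // mulmx1.
exists eta; split=> // k ltk.
pose z := unit_row R r 0 k; pose w := (f (0, z)).2.
have brF x y : vbracket (F x) (F y) = (f (0, vbracket x y)).2.
  by have := fbr (x, 0) (y, 0); rewrite {1}/hbracket /= => ->.
have adjJ : Fm^T *m (act N w)^T *m gram N *m Fm = - ((act M z)^T *m G).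
  apply/matrixP => i j; pose x : M := vec (delta_mx i 0); pose y : M := vec (delta_mx j 0).
  have -> : (Fm^T *m (act N w)^T *m gram N *m Fm) i j = pseudo_dot w (vbracket (F x) (F y)).
    rewrite -vbracketP gramE actE !FmE !vecK !trmx_mul trmx_delta -[LHS]delta_entry.
    by rewrite !mulmxA.
  have -> : (- ((act M z)^T *m G)) i j = - pseudo_dot z (vbracket x y).
    rewrite -vbracketP gramE actE !vecK trmx_mul trmx_delta [LHS]mxE -[X in - X = _]delta_entry.
    by rewrite !mulmxA.
  apply/eqP; rewrite brF -addr_eq0; apply/eqP.
  exact: (iso_center_form (0, z) (0, vbracket x y)).
have PFm' : P *m Fm' = Fm^T *m gram N by rewrite /P -mulmxA FmFm' mulmx1.
pose K := Fm' *m act N w *m Fm.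
have etaK : eta *m K = - act M z.
  apply: (can_inj (mulKmx Gu)); rewrite mulmxA Geta /K !mulmxA PFm' mulmxN -act_adj -/G.
  rewrite -[RHS]opprK -adjJ -[Fm^T *m (act N w)^T *m _]mulmxA act_adj.
  by rewrite mulmxN mulNmx opprK mulmxA.
have zz : pseudo_dot z z = 1.
  have ltk0 : (k < r + 0)%N by rewrite addn0.
  by rewrite /z (unit_rowE R (Ordinal ltk0)) sign_pos.
have KK : K *m K = 1%:M.
  have ww : pseudo_dot w w = -1.
    by have /eqP := iso_center_form (0, z) (0, z); rewrite addr_eq0 /= zz => /eqP.
  rewrite /K !mulmxA -[_ *m Fm *m Fm']mulmxA FmFm' mulmx1.
  rewrite -[_ *m act N w *m act N w]mulmxA act_sq ww.
  by rewrite opprK mulmx1 Fm'Fm.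
have KE : K = - (eta *m act M z) by rewrite -[LHS]mul1mx -eta2 -mulmxA etaK mulmxN.
have JJ : act M z *m act M z = - 1%:M by rewrite act_sq zz raddfN.
rewrite /act_gens -/z; set J := act M z in KE JJ *.
have eJe : eta *m J *m eta = - J.
  rewrite -[LHS]mulmx1 -[1%:M]opprK -JJ mulmxN mulmxA.
  by move: KK; rewrite KE mulNmx mulmxN opprK !mulmxA => ->; rewrite mul1mx.
by rewrite -[LHS]mulmx1 -eta2 mulmxA eJe mulNmx.
Qed.
End Grading.

(** * Absence of isomorphisms, and the theorem *)

(** With eta and one more J, the first n generators give a hyperbolic extension of
    the model, of dimension 2 d, inside M; but the N generators of the model give
    a module of Cl_{r,0} of dimension d. *)
Lemma not_integral_isomorphic (R : realType) r n N d (A : nat -> 'M[R]_d) eta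
    (M : admissible R r 0) (X : admissible R 0 r) :
  standard_module M -> model n N (fun=> -1) A eta ->
  (n < r <= N)%N -> ~ integral_isomorphic M X.
Proof.
move=> [hM /(_ erefl) pos] mo /andP[nr rN].
case=> m [p [v [Z [v' [Z' [f [ib ib' [_ fbr] fv fZ]]]]]]].
have [eta' [eta2 etaG etaJ]] := iso_grading pos ib ib' fv fZ fbr.
have r0 : (0 < r)%N by apply: leq_ltn_trans nr.
have sys : clifford_system (r + 0) 1 (fun=> -1) (gram M) 1%:M (act_gens M).
  by apply: act_gens_system; apply: sign_pos.
rewrite addn0 in sys.
have lt i : (i < n)%N -> (i < r.-1)%N by move=> /leq_trans; apply; rewrite -ltnS prednK.
have lt' i : (i < r.-1)%N -> (i < r)%N by move/leq_trans; apply; apply: leq_pred.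
have last_lt : (r.-1 < r)%N by rewrite prednK.
pose E i := match i with 0 => act_gens M r.-1 | 1 => eta' | i.+2 => act_gens M i end.
have sysE : clifford_system n.+2 1 (hyp_sign (fun=> -1)) (gram M) 1%:M E.
  constructor.
  - exact: cs_sym sys.
  - exact: cs_unit sys.
  - case=> [|[|i]] h; [exact: (cs_sq sys) | by rewrite mulr1 | by apply: (cs_sq sys); apply/lt'/lt].
  - have J i : (i < r)%N -> act_gens M i *m eta' = - (eta' *m act_gens M i).
      by move=> h; rewrite etaJ // opprK.
    have neq i : (i < n)%N -> i != r.-1 by move/lt => h; rewrite (ltn_eqF h).
    case=> [|[|i]] [|[|j]] hi hj //= ij.
    + exact: J.
    + by apply: (cs_anti sys); rewrite 1?eq_sym ?neq //; apply/lt'/lt.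
    + exact: etaJ.
    + exact/etaJ/lt'/lt.
    + by apply: (cs_anti sys); rewrite ?neq //; apply/lt'/lt.
    + exact/J/lt'/lt.
    + by apply: (cs_anti sys) => //; apply/lt'/lt.
  - case=> [|[|i]] h; [exact: (cs_adj sys) | by rewrite etaG scale1r |].
    by apply: (cs_adj sys); apply/lt'/lt.
  - by rewrite mulmx1.
  - by rewrite trmx1 mul1mx mulmx1.
  - by move=> i _; rewrite mul1mx mulmx1.
  - exact: cs_neq0 sys.
have hmo := hyp_model mo.
have := universal_dim (mo_univ hmo) (mo_eta2 hmo) (or_introl erefl) sysE.
move=> /leq_trans /(_ (minimal_dim_pos hM mo rN)).
by rewrite -[X in (_ <= X)%N]addn0 leq_add2l leqn0 eqn0Ngt (mo_gt0 mo).
Qed.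

Theorem theorem4p11 (R : realType) (r : nat) (hr : (1 <= r)%N)
    (M : admissible R r 0) (hM : standard_module M)
    (N : admissible R 0 r) (hN : standard_module N) :
  integral_isomorphic M N <->
  [\/ r = 0 %[mod 8], r = 1 %[mod 8], r = 2 %[mod 8] | r = 4 %[mod 8]].
Proof.
have [hM1 _] := hM; have [hN1 _] := hN.
have [A4 m4] := model4 R.
have iso n K d (A : nat -> 'M[R]_d) eta : model n K (fun=> -1) A eta -> (r %% 8 = n)%N ->
    integral_isomorphic M N.
  move=> mo rn; have [d' [A' [eta' mo']]] := model_family (r %/ 8)%N mo.
  have re : (r %/ 8 * 8 + n)%N = r by rewrite -rn -divn_eq.
  by rewrite re in mo'; apply: model_integral_isomorphic mo'.
have no n K d (A : nat -> 'M[R]_d) eta : model n K (fun=> -1) A eta -> (n < r %% 8 <= K)%N ->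
    ~ integral_isomorphic M N.
  move=> mo rn; have [d' [A' [eta' mo']]] := model_family (r %/ 8)%N mo.
  apply: not_integral_isomorphic hM mo' _.
  by rewrite {2 3}(divn_eq r 8) ltn_add2l leq_add2l.
split=> [hiso|].
  have := ltn_pmod r (isT : 0 < 8)%N.
  have no3 := no 2 3 _ _ _ (model2 R); have no4 := no 4 7 _ _ _ m4.
  case: (r %% 8)%N no3 no4 => [|[|[|[|[|q]]]]] no3 no4 q8.
  - by constructor 1.
  - by constructor 2.
  - by constructor 3.
  - by case: (no3 isT).
  - by constructor 4.
  - by case: no4.
by case=> rn; [apply: iso (model0 R) rn | apply: iso (model1 R) rn
  | apply: iso (model2 R) rn | apply: iso m4 rn].
Qed.
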